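(* Fix an integer $d\ge 0$. Let $L^d\subseteq \mathbb{Z}^{d+1}$ be the $\mathbb{Z}$-affine span of the $f$-vectors $(f_0,\dots,f_d)$ of the boundaries of all cubical $(d+1)$-dimensional polytopes, let $R^d$ be the set of all vectors in the $\mathbb{Q}$-affine span of $L^d$ all of whose entries are even integers, and let $F^d_0$ be the $f$-vector of the boundary of the $(d+1)$-cube, i.e. the coefficient vector of the polynomial $(2+t)^{d+1}-t^{d+1}$. Then $R^d-F^d_0=\{y : y+F^d_0\in R^d\}$ is a full rank sublattice of the lattice $L^d-F^d_0=\{y: y+F^d_0\in L^d\}$; that is, $R^d-F^d_0\subseteq L^d-F^d_0$ is a subgroup of the same rank.
   Context: A cubical polytope is a convex polytope all of whose proper (boundary) faces are combinatorially equivalent to cubes. The $f$-vector of the boundary of a $(d+1)$-polytope is $(f_0,\dots,f_d)$ where $f_i$ is the number of $i$-dimensional faces; equivalently the polynomial $\sum_i f_i t^i$. The $\mathbb{Z}$-affine span of a set $S$ of vectors is the set of combinations $\sum \lambda_i s_i$ with $s_i\in S$, $\lambda_i\in\mathbb{Z}$ and $\sum\lambda_i=1$; the $\mathbb{Q}$-affine span is defined likewise with $\lambda_i\in\mathbb{Q}$. *)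

(* Defs.v *)
From HB Require Import structures.
From mathcomp Require Import all_boot all_order all_algebra.
From mathcomp Require Import boolp reals.

Unset Printing Implicit Defensive.

Import Order.TTheory GRing.Theory Num.Theory.
Local Open Scope ring_scope.

(* A polytope in R^n is given as conv{ row i V | i < m } for V : 'M[R]_(m, n).
   Faces are described by the index sets of the given points they contain
   (a face F of conv(V) satisfies F = conv(F /\ {rows of V}), so F |-> F /\ V
   is injective on faces). *)
Section Polytope.
Variables (R : realType) (m n : nat) (V : 'M[R]_(m, n)).

Definition lin (a : 'rV[R]_n) (i : 'I_m) : R := \sum_(j < n) a 0 j * V i j.

(* T is (the index set of the points lying on) a face of the polytope
   conv { row i V | i \in D }: T = D /\ {x | a.x = b} for a valid inequality
   a.x <= b of that polytope.  Includes the empty face and the whole polytope. *)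
Definition is_face (D T : {set 'I_m}) : Prop :=
  T \subset D /\ exists (a : 'rV[R]_n) (b : R),
    forall i, i \in D -> lin a i <= b /\ (i \in T <-> lin a i = b).

Definition affdim (S : {set 'I_m}) : nat :=
  if [pick i in S] is Some i0 then
    \rank (\matrix_(i < m, j < n) (if i \in S then V i j - V i0 j else 0))
  else 0.

(* face poset of the k-cube [0,1]^k: nonempty faces <-> {0,1,*}^k
   (None = free coordinate), ordered by inclusion *)
Definition cube_le k (f g : {ffun 'I_k -> option bool}) : Prop :=
  forall j, g j = None \/ g j = f j.

(* the polytope conv { row i V | i \in S } is combinatorially equivalent to a
   cube: its poset of nonempty faces is isomorphic to that of some k-cube
   (the empty face is the bottom in both, so this is a face-lattice iso). *)
Definition comb_cube (S : {set 'I_m}) : Prop :=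
  exists (k : nat) (phi : {ffun 'I_k -> option bool} -> {set 'I_m}),
    (forall f g, @cube_le k f g <-> phi f \subset phi g) /\
    (forall T, (is_face S T /\ T != set0) <-> exists f, phi f = T).

Definition cubical : Prop :=
  forall S, is_face setT S -> S != set0 -> S != setT -> comb_cube S.

Definition fvec : 'rV[int]_n :=
  \row_(k < n) (#|[set T : {set 'I_m} |
        `[< is_face setT T >] && (T != set0) && (affdim T == k)]|)%:Z.

End Polytope.

Arguments lin {R m n} V a i.
Arguments is_face {R m n} V D T.
Arguments affdim {R m n} V S.
Arguments cube_le {k} f g.
Arguments comb_cube {R m n} V S.
Arguments cubical {R m n} V.
Arguments fvec {R m n} V.


Definition cubical_fvector (R : realType) (d : nat) (x : 'rV[int]_d.+1) : Prop :=
  exists (m : nat) (V : 'M[R]_(m, d.+1)),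
    affdim V setT = d.+1 /\ cubical V /\ x = @fvec R m d.+1 V.

Definition zaff_span {n : nat} (S : 'rV[int]_n -> Prop) (x : 'rV[int]_n) : Prop :=
  exists (k : nat) (c : 'I_k -> int) (v : 'I_k -> 'rV[int]_n),
    (forall i, S (v i)) /\ \sum_(i < k) c i = 1 /\ x = \sum_(i < k) c i *: v i.

Definition int2rat {n : nat} (x : 'rV[int]_n) : 'rV[rat]_n := map_mx (fun z : int => z%:~R) x.

Definition qaff_span {n : nat} (S : 'rV[int]_n -> Prop) (y : 'rV[rat]_n) : Prop :=
  exists (k : nat) (c : 'I_k -> rat) (v : 'I_k -> 'rV[int]_n),
    (forall i, S (v i)) /\ \sum_(i < k) c i = 1 /\
    y = \sum_(i < k) c i *: int2rat (v i).

Definition Lset (R : realType) (d : nat) : 'rV[int]_d.+1 -> Prop :=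
  @zaff_span d.+1 (cubical_fvector R d).

Definition Rset (R : realType) (d : nat) (x : 'rV[int]_d.+1) : Prop :=
  (forall j, (2 %| x ord0 j)%Z) /\ @qaff_span d.+1 (Lset R d) (int2rat x).

Definition F0 (d : nat) : 'rV[int]_d.+1 :=
  \row_(k < d.+1) ((2%:P + 'X) ^+ d.+1 - 'X^(d.+1) : {poly int})`_k.

Definition shift {n : nat} (S : 'rV[int]_n -> Prop) (F : 'rV[int]_n) (y : 'rV[int]_n) : Prop :=
  S (y + F).

Definition is_subgroup {n : nat} (A : 'rV[int]_n -> Prop) : Prop :=
  A 0 /\ forall x y, A x -> A y -> A (x - y).

Definition has_indep {n : nat} (A : 'rV[int]_n -> Prop) (k : nat) : Prop :=
  exists v : 'I_k -> 'rV[int]_n, (forall i, A (v i)) /\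
    row_free (\matrix_(i < k, j < n) ((v i 0 j)%:~R : rat)).

Definition same_rank {n : nat} (A B : 'rV[int]_n -> Prop) : Prop :=
  forall k, has_indep A k <-> has_indep B k.

(* Main.v *)
(* The relatively open polyhedral cones admit an Euler characteristic: cutting
   a cone of dimension k by a hyperplane gives pieces with (-1)^k = (-1)^k +
   (-1)^(k-1) + (-1)^k, so there is a linear functional on functions that sends
   the indicator of each such cone to (-1)^(its codimension). Applied to normal
   fans it yields Euler's relation and its local version at every face, hence
   the Dehn-Sommerville equations of cubical polytopes: the polynomial
   h(X) = f(-1-X) satisfies h(-X) = (-1)^d h(X) and h(0) = 1 + (-1)^d.
   The same functional gives h_k = C(N,k) ((-1)^k + (-1)^d) for the zonotope
   generated by N > d vectors in general position on the moment curve. The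
   matrix (C(d+1+j,k))_{j,k <= d} is unimodular, so every even vector that
   satisfies the equations is an integral affine combination of f-vectors of
   zonotopes; F_0^d itself is the case N = d+1. *)
Require Import Defs.
From HB Require Import structures.
From mathcomp Require Import all_boot all_order all_algebra.
From mathcomp Require Import boolp reals.
From mathcomp Require Import ring lra zify.

Set Implicit Arguments.
Unset Strict Implicit.
Unset Printing Implicit Defensive.

Import Order.TTheory GRing.Theory Num.Theory.
Local Open Scope ring_scope.

(** * Euler characteristic of relatively open polyhedral cones *)

Section Cones.
Variables (R : realFieldType) (n : nat).
Implicit Types (a b c u v w : 'rV[R]_n) (z s L : seq 'rV[R]_n).

(** Signs are taken by codimension because the normal cone of a face has codimension equal to the
    dimension of that face: a sum of (-1)^dim over faces becomes the Euler characteristic of a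
    region in the space of functionals. All that is used of the functional is that two finite
    families of cones with equal sums of indicators have equal sums of signs.

    The Dehn-Sommerville equations carry information through the rational span: a vector of [Rset]
    comes with no usable coefficients, but these equations survive affine combinations. Evenness
    pays for the factor (-1)^k + (-1)^d, which is 0 or twice a sign: for x = 2z the required values
    of the binomial combinations are, for k > 0, integers read off h(z), while at k = 0 the value 1
    is forced and says that the coefficients sum to 1. Equality of ranks is then cheap, since
    doubling maps L - F_0 into R - F_0. *)

Definition dot a u : R := \sum_(j < n) a 0 j * u 0 j.

Lemma dotC a u : dot a u = dot u a.
Proof. by apply: eq_bigr => j _; rewrite mulrC. Qed.

Lemma dotDr a u v : dot a (u + v) = dot a u + dot a v.
Proof. by rewrite -big_split; apply: eq_bigr => j _; rewrite mxE mulrDr. Qed.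

Lemma dotZr a t u : dot a (t *: u) = t * dot a u.
Proof. by rewrite mulr_sumr; apply: eq_bigr => j _; rewrite mxE mulrCA. Qed.

Lemma dotNr a u : dot a (- u) = - dot a u.
Proof. by rewrite -scaleN1r dotZr mulN1r. Qed.

Lemma dotBr a u v : dot a (u - v) = dot a u - dot a v.
Proof. by rewrite dotDr dotNr. Qed.

Lemma dotDl a b u : dot (a + b) u = dot a u + dot b u.
Proof. by rewrite dotC dotDr !(dotC u). Qed.

Lemma dotZl t a u : dot (t *: a) u = t * dot a u.
Proof. by rewrite dotC dotZr dotC. Qed.

Lemma dot0l u : dot 0 u = 0.
Proof. by rewrite -(scale0r 0) dotZl mul0r. Qed.

Lemma dot_sumr a (I : finType) (P : pred I) (F : I -> 'rV[R]_n) :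
  dot a (\sum_(i | P i) F i) = \sum_(i | P i) dot a (F i).
Proof.
apply: (big_ind2 (fun x y => dot a x = y)) => //; first by rewrite dotC dot0l.
by move=> ? ? ? ? <- <-; rewrite dotDr.
Qed.

Lemma dot_mulmx a u : u *m a^T = (dot a u)%:M.
Proof.
by apply/matrixP => i j; rewrite !ord1 !mxE eqxx mulr1n; apply: eq_bigr => k _;
  rewrite mxE mulrC.
Qed.

Lemma dot_mulmx_row (M : 'cV[R]_n) u : (u *m M == 0) = (dot M^T u == 0).
Proof.
rewrite -{1}[M]trmxK dot_mulmx; apply/eqP/eqP => [/matrixP /(_ 0 0)|->].
  by rewrite !mxE eqxx mulr1n.
by rewrite raddf0.
Qed.

Definition span_mx z : 'M[R]_n := foldr (fun u Z => (u + Z)%MS) 0 z.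
Definition rk z : nat := \rank (span_mx z).

Lemma span_mx_sub z p (M : 'M[R]_(p, n)) :
  (span_mx z <= M)%MS = all (fun u => u <= M)%MS z.
Proof. by elim: z => [|u z IH] /=; rewrite ?sub0mx // addsmx_sub IH. Qed.

Lemma mem_span_mx z u : u \in z -> (u <= span_mx z)%MS.
Proof.
move=> uz; have := submx_refl (span_mx z); rewrite span_mx_sub => /allP; exact.
Qed.

Lemma span_mx_mono z z' : {subset z <= z'} -> (span_mx z <= span_mx z')%MS.
Proof. by move=> h; rewrite span_mx_sub; apply/allP => u /h /mem_span_mx. Qed.

Lemma eq_mem_rk z z' : z =i z' -> rk z = rk z'.
Proof.
move=> h; apply/eqP; rewrite eqn_leq; apply/andP; split;
  by apply/mxrankS/span_mx_mono => u; rewrite h.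
Qed.

Lemma dot_span_mx z a u :
  (forall w, w \in z -> dot a w = 0) -> (u <= span_mx z)%MS -> dot a u = 0.
Proof.
move=> h uz; apply/eqP; rewrite -[a]trmxK -dot_mulmx_row; apply/eqP.
apply/sub_kermxP/(submx_trans uz); rewrite span_mx_sub; apply/allP => w /h dw.
by apply/sub_kermxP; rewrite dot_mulmx dw raddf0.
Qed.

Lemma separate_span z u : ~~ (u <= span_mx z)%MS ->
  exists b, (forall w, w \in z -> dot b w = 0) /\ dot b u != 0.
Proof.
rewrite submxE => /eqP nz.
have [j uj] : exists j, dot (col j (cokermx (span_mx z)))^T u != 0.
  apply/existsP; rewrite -[X in is_true X]negbK negb_exists; apply/negP => /forallP h.
  apply: nz; apply/matrixP => i j; have := h j; rewrite negbK ord1 => /eqP hj.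
  rewrite [RHS]mxE -[RHS]hj mxE; apply: eq_bigr => k _.
  by rewrite [X in _ = X * _]mxE [X in _ = X * _]mxE mulrC.
exists (col j (cokermx (span_mx z)))^T; split => // w /mem_span_mx.
rewrite submxE => /eqP /matrixP /(_ 0 j); rewrite [RHS]mxE mxE => h; rewrite -[RHS]h.
by apply: eq_bigr => k _; rewrite [X in X * _ = _]mxE [X in X * _ = _]mxE mulrC.
Qed.

Lemma rk_cons_in z u : (u <= span_mx z)%MS -> rk (u :: z) = rk z.
Proof. by move=> uz; rewrite /rk /= (addsmx_idPr uz). Qed.

Lemma rk_cons_notin z u : ~~ (u <= span_mx z)%MS -> rk (u :: z) = (rk z).+1.
Proof.
move=> uz; apply/eqP; rewrite eqn_leq; apply/andP; split.
  apply: leq_trans (mxrank_adds_leqif u (span_mx z)) _.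
  exact: (leq_add (rank_leq_row u) (leqnn (rk z))).
rewrite /rk /=; apply: rank_ltmx; rewrite /ltmx addsmxSr /=.
by apply: contra uz; apply: submx_trans; apply: addsmxSl.
Qed.

Definition cone z s a : bool :=
  all (fun u => dot a u == 0) z && all (fun u => dot a u < 0) s.

Lemma coneP z s a :
  reflect ((forall u, u \in z -> dot a u = 0) /\
           (forall u, u \in s -> dot a u < 0)) (cone z s a).
Proof.
apply: (iffP andP) => -[h1 h2]; split.
- by move=> u /(allP h1) /eqP.
- by move=> u /(allP h2).
- by apply/allP => u /h1 ->.
- by apply/allP => u /h2 ->.
Qed.

(** Strict inequalities are open conditions, so a nonempty cone spans the orthogonal complement of
    [z] and has codimension [rk z]. *)
Definition eul z s : int :=
  if `[< exists a, cone z s a >] then (-1) ^+ rk z else 0.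

Lemma eul_nonempty z s a : cone z s a -> eul z s = (-1) ^+ rk z.
Proof. by move=> h; rewrite /eul; case: asboolP => // -[]; exists a. Qed.

Lemma eul_empty z s : (forall a, ~~ cone z s a) -> eul z s = 0.
Proof. by move=> h; rewrite /eul; case: asboolP => // -[a]; rewrite (negPf (h a)). Qed.

Lemma small_perturbation s a b : (forall w, w \in s -> dot a w < 0) ->
  exists2 e : R, 0 < e &
    forall t, `|t| <= e -> forall w, w \in s -> dot (a + t *: b) w < 0.
Proof.
elim: s => [|u s IH] h; first by exists 1.
have [|e e0 he] := IH; first by move=> w ws; apply: h; rewrite inE ws orbT.
have au := h u (mem_head _ _).
have d0 : 0 < 1 + `|dot b u| by rewrite ltr_wpDr.
(* Half of the slack at [u]; the 1 keeps the denominator positive when [dot b u] vanishes. *)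
exists (Num.min e (- dot a u / 2 / (1 + `|dot b u|))).
  by rewrite lt_min e0 !divr_gt0 // oppr_gt0.
move=> t; rewrite le_min => /andP[te tu] w; rewrite inE => /predU1P[->|]; last exact: he.
rewrite dotDl dotZl; move: tu; rewrite ler_pdivlMr // => tu.
have : t * dot b u <= `|t| * `|dot b u| by rewrite -normrM ler_norm.
have := normr_ge0 t; nra.
Qed.

(** If [u] lies in the span of [z], it vanishes on the cone and only the middle piece remains.
    Otherwise a point of the slice can be pushed to either side and points on both sides yield one
    in the slice, so a nonempty cone has either all three pieces or a single open one. *)
Lemma eul_split z s u :
  eul z s = eul z (u :: s) + eul (u :: z) s + eul z (- u :: s).
Proof.
have [uz|uz] := boolP (u <= span_mx z)%MS.
  have zero a : cone z s a -> dot a u = 0.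
    by case/coneP => h _; apply: (dot_span_mx h uz).
  rewrite [eul z (u :: s)]eul_empty ?[eul z (- u :: s)]eul_empty ?addr0 ?add0r.
  - rewrite /eul (rk_cons_in uz); congr (if _ then _ else _).
    apply/asbool_equiv_eq; split=> -[a h]; exists a.
      by rewrite /cone /= (zero _ h) eqxx.
    by case/andP: h => /= /andP[_ h1] h2; rewrite /cone h1.
  - move=> a; apply/negP => /coneP[h1 h2].
    have : cone z s a by apply/coneP; split=> // w ws; apply: h2; rewrite inE ws orbT.
    by move/zero => e; have := h2 _ (mem_head _ _); rewrite dotNr e oppr0 ltxx.
  - move=> a; apply/negP => /coneP[h1 h2].
    have : cone z s a by apply/coneP; split=> // w ws; apply: h2; rewrite inE ws orbT.
    by move/zero => e; have := h2 _ (mem_head _ _); rewrite e ltxx.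
have [b [bz bu]] := separate_span uz.
rewrite /eul (rk_cons_notin uz) exprS mulN1r.
have sub v a : cone z (v :: s) a -> cone z s a.
  by case/andP=> h1 /= /andP[_ h2]; rewrite /cone h1.
have sub0 a : cone (u :: z) s a -> cone z s a.
  by case/andP=> /= /andP[_ h1] h2; rewrite /cone h1.
have move_off a v : cone (u :: z) s a -> v = u \/ v = - u ->
    exists a', cone z (v :: s) a'.
  move=> /coneP[h1 h2] vu.
  have [e e0 he] := small_perturbation b h2.
  have av : dot a v = 0.
    by have := h1 u (mem_head _ _); case: vu => ->; rewrite ?dotNr => ->; rewrite ?oppr0.
  have bv : dot b v != 0 by case: vu => ->; rewrite ?dotNr ?oppr_eq0.
  exists (a + (- Num.sg (dot b v) * e) *: b); apply/coneP; split.
    move=> w wz; rewrite dotDl dotZl (bz w wz) mulr0 addr0.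
    by apply: h1; rewrite inE wz orbT.
  move=> w; rewrite inE => /predU1P[->|ws].
    rewrite dotDl dotZl av add0r mulrAC mulNr mulNr -normrEsg oppr_lt0.
    by rewrite mulr_gt0 // normr_gt0.
  by apply: he => //; rewrite normrM normrN normr_sg bv mul1r ger0_norm // ltW.
have cross : (exists a, cone z (u :: s) a) -> (exists a, cone z (- u :: s) a) ->
    exists a, cone (u :: z) s a.
  move=> [a1 /coneP[h1 k1]] [a2 /coneP[h2 k2]].
  have d1 := k1 _ (mem_head _ _); have d2 := k2 _ (mem_head _ _).
  rewrite dotNr oppr_lt0 in d2.
  (* A positive multiple of the point where the segment from [a1] to [a2] crosses the hyperplane. *)
  exists (dot a2 u *: a1 + (- dot a1 u) *: a2); apply/coneP; split=> w.
    rewrite inE dotDl !dotZl => /predU1P[->|wz]; first by ring.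
    by rewrite (h1 w wz) (h2 w wz) !mulr0 addr0.
  move=> ws; rewrite dotDl !dotZl.
  have := k1 w; have := k2 w; rewrite !inE ws !orbT => /(_ isT) ? /(_ isT) ?.
  nra.
have tri a : cone z s a ->
    [\/ cone z (u :: s) a, cone (u :: z) s a | cone z (- u :: s) a].
  case/andP=> h1 h2; rewrite /cone /= h1 h2 dotNr oppr_lt0 !andbT.
  by case: (ltgtP (dot a u) 0) => _; [apply: Or31|apply: Or33|apply: Or32].
do 4 case: asboolP; move=> H1 H2 H3 H4; try by ring.
all: exfalso.
all: try by case: H4 => a /tri[]?; [apply: H3|apply: H2|apply: H1]; exists a.
all: try by case: H3 => a /sub ?; apply: H4; exists a.
all: try by case: H2 => a /sub0 ?; apply: H4; exists a.
all: try by case: H1 => a /sub ?; apply: H4; exists a.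
all: try by apply: H2; apply: cross.
all: try by case: H2 => a /move_off/(_ (or_introl erefl)).
all: try by case: H2 => a /move_off/(_ (or_intror erefl)).
Qed.

Implicit Type f : 'rV[R]_n -> int.

(* The integral of [f] with respect to the Euler characteristic, [f] being
   sampled at one point of each cell of the arrangement of the hyperplanes
   orthogonal to the vectors of [L] inside [cone z s]. *)
Fixpoint euler_int f L z s : int :=
  match L with
  | [::] => if pselect (exists a, cone z s a) is left h
            then f (projT1 (cid h)) * (-1) ^+ rk z else 0
  | u :: L' => euler_int f L' z (u :: s) + euler_int f L' (u :: z) s
               + euler_int f L' z (- u :: s)
  end.

Lemma euler_int_sum (I : finType) (P : pred I) (F : I -> 'rV[R]_n -> int) L z s :
  euler_int (fun a => \sum_(i | P i) F i a) L z s =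
  \sum_(i | P i) euler_int (F i) L z s.
Proof.
elim: L z s => [|u L IH] z s /=; last by rewrite !IH -!big_split.
by case: pselect => [h|_]; rewrite ?mulr_suml // big1.
Qed.

Lemma eq_euler_int f g L z s : f =1 g -> euler_int f L z s = euler_int g L z s.
Proof.
move=> h; elim: L z s => [|u L IH] z s /=; last by rewrite !IH.
by case: pselect => // ?; rewrite h.
Qed.

(** Once every vector defining [cone z' s'] has a fixed sign on [cone z s], the latter lies inside
    the former or misses it, so the choice of sample point is irrelevant. The alternative
    [- u \in s] accounts for the negative side of a cut. *)
Lemma euler_int_cone L z s z' s' :
  (forall u, u \in z' ++ s' -> [|| u \in L, u \in z, u \in s | - u \in s]) ->
  euler_int (fun a => (cone z' s' a)%:R) L z s = eul (z ++ z') (s ++ s').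
Proof.
elim: L z s => [|u L IH] z s h /=.
  have coneD a : cone (z ++ z') (s ++ s') a = cone z s a && cone z' s' a.
    by rewrite /cone !all_cat andbACA.
  case: pselect => [e|ne]; last first.
    by rewrite eul_empty // => a; rewrite coneD; apply/negP => /andP[ca _]; apply: ne; exists a.
  case: (cid e) => a ca /=; case/coneP: (ca) => zero neg.
  have [ca'|ca'] := boolP (cone z' s' a).
    rewrite (@eul_nonempty _ _ a) ?coneD ?ca //= mul1r; congr (_ ^+ _).
    apply/eq_mem_rk => w; rewrite mem_cat; have [//|wz] := boolP (w \in z).
    apply/esym/negbTE/negP => /= wz'; case/coneP: ca' => /(_ _ wz') dw _.
    have := h w; rewrite mem_cat wz' (negPf wz) /= => /(_ isT) /orP[]/neg.
      by rewrite dw ltxx.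
    by rewrite dotNr dw oppr0 ltxx.
  rewrite mul0r eul_empty // => b; rewrite coneD; apply/negP => /andP[cb cb'].
  case/negP: ca'; case/coneP: cb => bz bs; case/coneP: cb' => bz' bs'.
  apply/coneP; split=> w wm; have := h w; rewrite mem_cat wm ?orbT => /(_ isT) /=.
    case/or3P => [/zero //|/bs|/bs]; rewrite ?dotNr bz' ?oppr0 ?ltxx //.
  have bw := bs' _ wm.
  by case/or3P => [/bz|/neg //|/bs]; rewrite ?dotNr => e1; move: bw; rewrite ?e1 ?ltxx //; lra.
rewrite !IH ?(eul_split (z ++ z') (s ++ s') u) //.
- move=> w /h; rewrite !inE => /or4P[/predU1P[->|->]|->|->|->]; rewrite ?opprK ?eqxx ?orbT //.
- by move=> w /h; rewrite !inE => /or4P[/predU1P[->|->]|->|->|->]; rewrite ?eqxx ?orbT.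
- by move=> w /h; rewrite !inE => /or4P[/predU1P[->|->]|->|->|->]; rewrite ?eqxx ?orbT.
Qed.

(** The defining vectors of both families go into one list, so that both sums of indicators are
    sampled at the same points. *)
Theorem eul_sum_eq (I J : finType) (P : pred I) (Q : pred J)
    (z s : I -> seq 'rV[R]_n) (z' s' : J -> seq 'rV[R]_n) :
  (forall a, \sum_(i | P i) (cone (z i) (s i) a)%:R =
             \sum_(j | Q j) (cone (z' j) (s' j) a)%:R :> int) ->
  \sum_(i | P i) eul (z i) (s i) = \sum_(j | Q j) eul (z' j) (s' j).
Proof.
move=> h.
pose L := flatten [seq z i ++ s i | i : I] ++ flatten [seq z' j ++ s' j | j : J].
have LI i u : u \in z i ++ s i -> u \in L.
  move=> ui; rewrite mem_cat; apply/orP; left; apply/flattenP.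
  by exists (z i ++ s i) => //; apply: map_f; rewrite mem_enum.
have LJ j u : u \in z' j ++ s' j -> u \in L.
  move=> ui; rewrite mem_cat; apply/orP; right; apply/flattenP.
  by exists (z' j ++ s' j) => //; apply: map_f; rewrite mem_enum.
transitivity (euler_int (fun a => \sum_(i | P i) (cone (z i) (s i) a)%:R) L [::] [::]).
  rewrite euler_int_sum; apply: eq_bigr => i _.
  by rewrite euler_int_cone // => u /LI ->.
rewrite (eq_euler_int _ _ _ h) euler_int_sum; apply: eq_bigr => i _.
by rewrite euler_int_cone // => u /LJ ->.
Qed.

End Cones.

(** * Euler relations in the face lattice of a polytope *)

Section ArgMax.
Variables (R : realFieldType) (T : finType).
Implicit Types (phi : T -> R) (A D : {set T}).

Definition argmax_set phi D : {set T} :=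
  [set i in D | [forall (j | j \in D), phi j <= phi i]].

Lemma argmax_set_neq0 phi D : D != set0 -> argmax_set phi D != set0.
Proof.
case/set0Pn => i iD; apply/set0Pn.
case: (@arg_maxP _ _ _ i (fun k => k \in D) phi iD) => k kD hk; exists k.
by rewrite inE kD; apply/forall_inP => j /hk.
Qed.

Lemma eq_argmax_set phi D A j : A \subset D -> j \in A ->
  (A == argmax_set phi D) =
  [forall (i | i \in A), phi i == phi j] && [forall (i | i \in D :\: A), phi i < phi j].
Proof.
move=> /subsetP AD jA; apply/eqP/andP => [e|[/forall_inP h1 /forall_inP h2]].
  have jm : j \in argmax_set phi D by rewrite -e.
  move: jm; rewrite inE => /andP[jD /forall_inP hj]; split.
    apply/forall_inP => i; rewrite e inE => /andP[iD /forall_inP hi].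
    by rewrite eq_le hj // hi.
  apply/forall_inP => i; rewrite inE => /andP[iA iD].
  rewrite lt_neqAle hj // andbT; apply: contra iA => /eqP eij.
  by rewrite e inE iD; apply/forall_inP => k /hj; rewrite eij.
apply/setP => i; rewrite inE; apply/idP/andP => [iA|[iD /forall_inP hi]].
  split; first exact: AD; apply/forall_inP => k kD; rewrite (eqP (h1 i iA)).
  have [kA|kA] := boolP (k \in A); first by rewrite (eqP (h1 k kA)).
  by rewrite ltW // h2 // inE kA.
have [//|iA] := boolP (i \in A); have := h2 i; rewrite inE iA iD => /(_ isT).
by rewrite ltNge hi // AD.
Qed.

End ArgMax.

Section Faces.
Variables (R : realType) (m n : nat) (V : 'M[R]_(m, n)).
Implicit Types (F G H D S T : {set 'I_m}) (a b c : 'rV[R]_n) (g i j : 'I_m).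

Definition edge g i : 'rV[R]_n := row i V - row g V.

Lemma lin_dot a i : lin V a i = dot a (row i V).
Proof. by apply: eq_bigr => j _; rewrite mxE. Qed.

Lemma dot_edge a g i : dot a (edge g i) = lin V a i - lin V a g.
Proof. by rewrite dotBr !lin_dot. Qed.

Definition edges g T := [seq edge g i | i in T].

Lemma edgesP g T u : reflect (exists2 i, i \in T & u = edge g i) (u \in edges g T).
Proof. exact: imageP. Qed.

Lemma mem_edges g T i : i \in T -> edge g i \in edges g T.
Proof. by move=> iT; apply/edgesP; exists i. Qed.

(** For [g] in [T], the relatively open normal cone: the functionals whose maximum over [D] is
    attained exactly on [T]. *)
Definition normal_cone D T g a : bool := cone (edges g T) (edges g (D :\: T)) a.

Lemma normal_coneP D T g a :
  reflect ((forall i, i \in T -> lin V a i = lin V a g) /\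
           (forall i, i \in D -> i \notin T -> lin V a i < lin V a g))
          (normal_cone D T g a).
Proof.
apply: (iffP (coneP _ _ _)) => -[h1 h2]; split.
- by move=> i iT; apply/eqP; rewrite -subr_eq0 -dot_edge h1 // mem_edges.
- by move=> i iD iT; rewrite -subr_lt0 -dot_edge h2 // mem_edges // inE iT.
- by move=> u /edgesP[i iT ->]; rewrite dot_edge h1 ?subrr.
- by move=> u /edgesP[i]; rewrite inE => /andP[iT iD] ->; rewrite dot_edge subr_lt0 h2.
Qed.

Lemma face_sub D T : is_face V D T -> T \subset D. Proof. by case. Qed.

Lemma faceP D T g : g \in T ->
  is_face V D T <-> T \subset D /\ exists a, normal_cone D T g a.
Proof.
move=> gT; split=> -[TD].
  case=> a [b h]; split=> //; exists a; apply/normal_coneP.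
  have hg : lin V a g = b by have [_ e] := h g (subsetP TD _ gT); apply/e.
  split=> i; first by move=> iT; rewrite hg; have [_ e] := h i (subsetP TD _ iT); apply/e.
  move=> iD iT; have [le_b e] := h i iD; rewrite hg lt_neqAle le_b andbT.
  by apply: contraNN iT => /eqP/e.
case=> a /normal_coneP[h1 h2]; split=> //; exists a, (lin V a g) => i iD.
have [iT|iT] := boolP (i \in T); first by rewrite h1.
by split; [rewrite ltW ?h2|split=> // e; have := h2 i iD iT; rewrite e ltxx].
Qed.

Lemma affdim_rk T g : g \in T -> affdim V T = rk (edges g T).
Proof.
move=> gT; rewrite /affdim; case: pickP => [i0 i0T|/(_ g)]; last by rewrite gT.
apply/eqP; rewrite eqn_leq; apply/andP; split; apply: mxrankS.
  apply/row_subP => i; have [iT|iT] := boolP (i \in T); last first.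
    rewrite (_ : row i _ = 0) ?sub0mx //.
    by apply/rowP => j; rewrite !mxE (negPf iT).
  rewrite (_ : row i _ = edge g i - edge g i0).
    by rewrite addmx_sub ?eqmx_opp // mem_span_mx // mem_edges.
  by apply/rowP => j; rewrite !mxE iT; ring.
rewrite span_mx_sub; apply/allP => u /edgesP[i iT ->]; set M := \matrix_(_, _) _.
rewrite (_ : edge g i = row i M - row g M); first by rewrite addmx_sub ?eqmx_opp // row_sub.
by apply/rowP => j; rewrite !mxE iT gT; ring.
Qed.

(** The cone of a set that is not a face is empty and contributes 0, which lets later sums run over
    all index sets. *)
Lemma eul_normal_cone D T g : g \in T -> T \subset D ->
  eul (edges g T) (edges g (D :\: T)) =
  if `[< is_face V D T >] then (-1) ^+ affdim V T else 0.
Proof.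
move=> gT TD; rewrite /eul -(affdim_rk gT); congr (if _ then _ else _).
apply/asbool_equiv_eq; rewrite (faceP D gT); split; last by case.
by case=> a ha; split=> //; exists a.
Qed.

Lemma normal_cone_argmax D T g a : g \in T -> T \subset D ->
  normal_cone D T g a = (T == argmax_set (lin V a) D).
Proof.
move=> gT TD; rewrite (eq_argmax_set _ TD gT); apply/normal_coneP/andP => -[h1 h2].
  split; first by apply/forall_inP => i /h1 ->.
  by apply/forall_inP => i; rewrite inE => /andP[? ?]; apply: h2.
split=> i; first by move/(forall_inP h1) => /eqP.
by move=> iD iT; apply: (forall_inP h2); rewrite inE iT.
Qed.

Lemma argmax_face a D : D != set0 -> is_face V D (argmax_set (lin V a) D).
Proof.
move=> D0; have /set0Pn[g gT] := argmax_set_neq0 (lin V a) D0.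
have TD : argmax_set (lin V a) D \subset D by apply/subsetP => i; rewrite inE => /andP[].
by apply/(faceP _ gT); split=> //; exists a; rewrite normal_cone_argmax.
Qed.

(** A small multiple of a functional exposing [H] in [G] is added to one exposing [G]: strict
    inequalities outside [G] survive and the ties inside [G] are broken. *)
Lemma face_trans D G H : is_face V D G -> is_face V G H -> H != set0 -> is_face V D H.
Proof.
move=> fG fH /set0Pn[h hH]; have GD := face_sub fG; have HG := face_sub fH.
have hG := subsetP HG h hH.
apply/(faceP _ hH); split; first exact: subset_trans GD.
have /(faceP _ hG)[_ [a /coneP[az an]]] := fG.
have /(faceP _ hH)[_ [b /coneP[bz bn]]] := fH.
have [e e0 he] := small_perturbation b an.
exists (a + e *: b); apply/coneP; split=> u /edgesP[i].
  move=> iH ->; rewrite dotDl dotZl az ?bz ?mulr0 ?addr0 ?mem_edges //.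
  exact: (subsetP HG).
rewrite inE => /andP[iH iD] ->; have [iG|iG] := boolP (i \in G).
  by rewrite dotDl dotZl az ?mem_edges // add0r pmulr_rlt0 // bn // mem_edges // inE iH.
by apply: he; rewrite ?gtr0_norm // mem_edges // inE iG.
Qed.

Lemma face_restrict D G H : G \subset D -> H \subset G -> is_face V D H -> is_face V G H.
Proof.
move=> GD HG [_ [a [b h]]]; split=> //; exists a, b => i /(subsetP GD); exact: h.
Qed.

Lemma face_refl D : is_face V D D.
Proof.
split=> //; exists 0, 0 => i iD; rewrite lin_dot dot0l; split=> //; by split.
Qed.

(** A functional exposing [F] vanishes on the edges within [F] but not on an edge leaving it, so the
    latter is independent of the former. *)
Lemma affdim_lt D F G : is_face V D F -> F != set0 -> G \subset D -> F \proper G ->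
  (affdim V F < affdim V G)%N.
Proof.
move=> fF /set0Pn[f fF'] GD /properP[FG [i iG iF]].
rewrite (affdim_rk fF') (affdim_rk (subsetP FG f fF')).
have /(faceP _ fF')[_ [a /coneP[az an]]] := fF.
have iz : ~~ (edge f i <= span_mx (edges f F))%MS.
  apply/negP => /(dot_span_mx az) e.
  have := an (edge f i); rewrite e ltxx => /(_ (mem_edges _ _)).
  by rewrite inE iF (subsetP GD) // => /(_ isT).
rewrite -(rk_cons_notin iz); apply/mxrankS/span_mx_mono => u.
by rewrite inE => /predU1P[->|/edgesP[k kF ->]]; apply: mem_edges => //; apply: (subsetP FG).
Qed.

(* Rotating the supporting hyperplane of [F] in a direction orthogonal to [F]
   and to an edge leaving [F] produces a larger face that avoids this edge. *)
Lemma face_between D F G : is_face V D F -> F != set0 -> is_face V D G ->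
  F \proper G -> ((affdim V F).+1 < affdim V G)%N ->
  exists H, [/\ is_face V D H, F \proper H & H \proper G].
Proof.
move=> fF /set0Pn[f fF'] fG /[dup] pFG /properP[FG [i1 i1G i1F]] dimFG.
have GD := face_sub fG; have fG' := subsetP FG f fF'.
have fFG := face_restrict GD FG fF.
have /(faceP _ fF')[_ [c /coneP[cz cn]]] := fFG.
pose z := edge f i1 :: edges f F.
have [i2 i2G i2z] : exists2 i2, i2 \in G & ~~ (edge f i2 <= span_mx z)%MS.
  apply: contrapT => hn; move: dimFG; rewrite (affdim_rk fF') (affdim_rk fG') ltnNge.
  apply/negP; rewrite negbK; apply: (@leq_trans (rk z)).
    apply: mxrankS; rewrite span_mx_sub; apply/allP => u /edgesP[i iG ->].
    by apply: contrapT => /negP ?; apply: hn; exists i.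
  have [hz|hz] := boolP (edge f i1 <= span_mx (edges f F))%MS.
    by rewrite rk_cons_in.
  by rewrite rk_cons_notin.
have [b0 [b0z b0i]] := separate_span i2z.
pose b := Num.sg (dot b0 (edge f i2)) *: b0.
have bz u : u \in z -> dot b u = 0 by move=> uz; rewrite dotZl (b0z u uz) mulr0.
have bi2 : 0 < dot b (edge f i2) by rewrite dotZl -normrEsg normr_gt0.
have cneg i : i \in G -> i \notin F -> dot c (edge f i) < 0.
  by move=> iG iF; apply: cn; rewrite mem_edges // inE iF.
have i2F : i2 \notin F.
  by apply: contraNN i2z => i2F; apply: mem_span_mx; rewrite inE mem_edges ?orbT.
(* The largest ratio is the least [t] for which [b + t *: c] is nonpositive on all edges from [f]
   into [G]. The maximiser joins the new face; the ratio is positive because of [i2], which keeps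
   [i1] out, as [b] vanishes on its edge. *)
pose ratio i := dot b (edge f i) / - dot c (edge f i).
have hDF : i1 \in G :\: F by rewrite inE i1F.
case: (@arg_maxP _ _ _ i1 (fun k => k \in G :\: F) ratio hDF) => k.
rewrite /= inE => /andP[kF kG] hk.
pose a := b + ratio k *: c.
have posk : 0 < ratio k.
  apply: lt_le_trans (hk i2 _); last by rewrite inE i2F.
  by rewrite divr_gt0 // oppr_gt0 cneg.
have aF i : i \in F -> dot a (edge f i) = 0.
  by move=> iF; rewrite dotDl dotZl bz ?cz ?mulr0 ?addr0 // ?inE mem_edges ?orbT.
have aG i : i \in G -> dot a (edge f i) <= 0.
  move=> iG; have [/aF->//|iF] := boolP (i \in F).
  have := hk i; rewrite /= inE iF iG => /(_ isT); rewrite /ratio.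
  rewrite ler_pdivrMr ?oppr_gt0 ?cneg // dotDl dotZl -/(ratio k).
  by rewrite mulrN => ?; lra.
have ak : dot a (edge f k) = 0.
  rewrite dotDl dotZl /ratio; have := cneg k kG kF => h; field.
  by rewrite ?oppr_eq0 lt_eqF.
have ai1 : dot a (edge f i1) < 0.
  by rewrite dotDl dotZl bz ?mem_head // add0r pmulr_rlt0 // cneg.
have mem_H i : i \in G -> dot a (edge f i) = 0 -> i \in argmax_set (lin V a) G.
  move=> iG e; rewrite inE iG; apply/forall_inP => j jG.
  by have := aG j jG; move: e; rewrite !dot_edge; lra.
have G0 : G != set0 by apply/set0Pn; exists f.
exists (argmax_set (lin V a) G); split.
- apply: face_trans fG _ _; [exact: argmax_face|exact: argmax_set_neq0].
- apply/properP; split; last by exists k; rewrite // mem_H.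
  by apply/subsetP => i iF; apply: mem_H; [exact: (subsetP FG)|exact: aF].
- apply/properP; split; first by apply/subsetP => i; rewrite inE => /andP[].
  exists i1 => //; rewrite inE i1G; apply/negP => /forall_inP /(_ f fG').
  by move: ai1; rewrite dot_edge; lra.
Qed.

(** Positive dimension provides a functional that is not constant on [G]; its maximum is attained on
    a smaller face. *)
Lemma face_below D G : is_face V D G -> G != set0 -> (0 < affdim V G)%N ->
  exists H, [/\ is_face V D H, H != set0 & H \proper G].
Proof.
move=> fG G0 dG; have /set0Pn[g gG] := G0.
have [i iG iz] : exists2 i, i \in G & ~~ (edge g i <= span_mx [::])%MS.
  apply: contrapT => hn; move: dG; rewrite (affdim_rk gG) lt0n; apply/negP; rewrite negbK.
  rewrite mxrank_eq0 -submx0 span_mx_sub; apply/allP => u /edgesP[i iG ->].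
  by apply: contrapT => /negP ?; apply: hn; exists i.
have [b [_ bi]] := separate_span iz.
exists (argmax_set (lin V b) G); split; last 1 first.
- apply/properP; split; first by apply/subsetP => j; rewrite inE => /andP[].
  apply: contrapT => hn.
  have hall j : j \in G -> j \in argmax_set (lin V b) G.
    by move=> jG; apply: contrapT => /negP ?; apply: hn; exists j.
  have := hall g gG; have := hall i iG; rewrite !inE iG gG /=.
  move=> /forall_inP/(_ g gG) h1 /forall_inP/(_ i iG) h2; move: bi.
  by rewrite dot_edge subr_eq0 eq_le h1 h2.
- by apply: face_trans fG _ _; [exact: argmax_face|exact: argmax_set_neq0].
- exact: argmax_set_neq0.
Qed.

(* The normal cones of the nonempty faces partition the dual space. *)
Lemma euler_relation : (0 < m)%N ->
  \sum_(G | `[< is_face V setT G >] && (G != set0)) (-1) ^+ affdim V G = 1%R :> int.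
Proof.
move=> m0; pose i0 := Ordinal m0; pose g G := odflt i0 [pick i in G].
have gP G : G != set0 -> g G \in G.
  by case/set0Pn => i iG; rewrite /g; case: pickP => //= /(_ i); rewrite iG.
transitivity (\sum_(G | G != set0) eul (edges (g G) G) (edges (g G) (setT :\: G))).
  rewrite big_mkcondl; apply: eq_bigr => G /gP gG.
  by rewrite eul_normal_cone // subsetT.
(* The comparison family is a single cone without conditions: the whole space, of sign 1. *)
rewrite (@eul_sum_eq _ _ _ unit _ xpredT _ _ (fun=> [::]) (fun=> [::])).
  rewrite big_const card_unit /= addr0 (@eul_nonempty _ _ _ _ 0) //.
  by rewrite /rk /= mxrank0.
move=> a; rewrite [RHS]big_const card_unit /= addr0.
have T0 : [set: 'I_m] != set0 by apply/set0Pn; exists i0.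
rewrite (bigD1 (argmax_set (lin V a) setT)) /= ?argmax_set_neq0 // big1 ?addr0.
  by rewrite -/(normal_cone _ _ _ _) normal_cone_argmax ?subsetT ?gP ?argmax_set_neq0 ?eqxx.
move=> G /andP[/gP gG ne].
by rewrite -/(normal_cone _ _ _ _) normal_cone_argmax ?subsetT // (negPf ne).
Qed.

End Faces.

(** * Euler's relation for the faces containing a given face *)

Section LocalEuler.
Variables (R : realType) (m n : nat) (V : 'M[R]_(m, n)).
Implicit Types (F G A : {set 'I_m}) (a : 'rV[R]_n) (i j : 'I_m).

(* The normal cones of the faces containing [F] partition the closed normal
   cone of [F]. With [c] in the relative interior of that cone, the same closed
   cone is also cut into the pieces on which a given set [A] of its rescaled
   defining functionals [mu i] is maximal; such a piece is the product of a
   relatively open cone with a closed half-line in the direction of [c], so its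
   Euler characteristic vanishes. *)
Lemma local_euler_relation F : is_face V setT F -> F != set0 -> F != setT ->
  \sum_(G | `[< is_face V setT G >] && (F \subset G)) (-1) ^+ affdim V G = 0%R :> int.
Proof.
move=> fF /set0Pn[f fF'] FT.
have /(faceP _ _ fF')[_ [c /coneP[cz cn]]] := fF.
have FC0 : ~: F != set0 by rewrite -setCT (inj_eq (@setC_inj _)).
have cneg i : i \in ~: F -> dot c (edge V f i) < 0.
  by move=> iF; apply: cn; rewrite mem_edges // setTD.
(* After rescaling, [c] takes the value -1 on every [mu i] with [i] outside [F], so moving along [c]
   shifts these values equally and preserves which are maximal. *)
pose mu i := (- dot c (edge V f i))^-1 *: edge V f i.
have mu_le0 a i : i \in ~: F -> (dot a (mu i) <= 0) = (lin V a i <= lin V a f).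
  move=> iF; rewrite -[RHS]subr_le0 -dot_edge dotZr pmulr_rle0 //.
  by rewrite invr_gt0 oppr_gt0 cneg.
have cmu i : i \in ~: F -> dot c (mu i) = -1.
  by move=> /cneg h; rewrite dotZr invrN mulNr mulVf // lt_eqF.
pose g A := odflt f [pick i in A].
have gP A : A != set0 -> g A \in A.
  by case/set0Pn => i iA; rewrite /g; case: pickP => //= /(_ i); rewrite iA.
pose zA A := edges V f F ++ [seq mu i - mu (g A) | i in A].
pose sA A := [seq mu i - mu (g A) | i in ~: F :\: A].
(* The flag splits the closed half-line into its endpoint, where the maximal [mu] vanishes, and the
   open ray, where it is negative. *)
pose z' (p : {set 'I_m} * bool) := if p.2 then mu (g p.1) :: zA p.1 else zA p.1.
pose s' (p : {set 'I_m} * bool) := if p.2 then sA p.1 else mu (g p.1) :: sA p.1.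
pose good A := (A != set0) && (A \subset ~: F).
transitivity (\sum_(G : {set _} | F \subset G) eul (edges V f G) (edges V f (setT :\: G))).
  rewrite big_mkcondl; apply: eq_bigr => G /subsetP/(_ f fF') fG.
  by rewrite eul_normal_cone // subsetT.
rewrite (@eul_sum_eq _ _ _ _ _ (fun p => good p.1 && true) _ _ z' s').
  rewrite -(pair_big good xpredT (fun A b => eul (z' (A, b)) (s' (A, b)))) /=.
  apply: big1 => A /andP[A0 AF]; rewrite big_bool /z' /s' /=.
  have gF : g A \in ~: F by apply: (subsetP AF); apply: gP.
  have czA u : u \in zA A -> dot c u = 0.
    rewrite mem_cat => /orP[/cz //|/imageP[i iA ->]].
    by rewrite dotBr !cmu ?subrr // (subsetP AF).
  have csA u : u \in sA A -> dot c u = 0.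
    move=> /imageP[i]; rewrite inE => /andP[_ iF] ->.
    by rewrite dotBr !cmu ?subrr.
  have mu_notin : ~~ (mu (g A) <= span_mx (zA A))%MS.
    apply/negP => /(dot_span_mx czA); rewrite cmu // => /eqP.
    by rewrite oppr_eq0 oner_eq0.
  have [[a ca]|ne] := pselect (exists a, cone (zA A) (sA A) a); last first.
    rewrite !eul_empty ?addr0 // => a; apply/negP => /andP[/= h1 h2]; apply: ne; exists a.
      by apply/andP; split=> //; case/andP: h2.
    by apply/andP; split=> //; case/andP: h1.
  case/coneP: ca => az an.
  have shift_zA t u : u \in zA A -> dot (a + t *: c) u = 0.
    by move=> uz; rewrite dotDl dotZl az // czA // mulr0 addr0.
  have shift_sA t u : u \in sA A -> dot (a + t *: c) u < 0.
    by move=> us; rewrite dotDl dotZl csA // mulr0 addr0 an.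
  have shift_mu t : dot (a + t *: c) (mu (g A)) = dot a (mu (g A)) - t.
    by rewrite dotDl dotZl cmu // mulrN1.
  (* The two shifts along [c] give [mu (g A)] the values 0 and -1, so both pieces are nonempty, of
     codimensions differing by one. *)
  rewrite (@eul_nonempty _ _ _ _ (a + dot a (mu (g A)) *: c)); last first.
    apply/coneP; split=> [u|u us]; last exact: shift_sA.
    by rewrite inE => /predU1P[->|/shift_zA //]; rewrite shift_mu subrr.
  rewrite (@eul_nonempty _ _ (zA A) _ (a + (dot a (mu (g A)) + 1) *: c)); last first.
    apply/coneP; split=> [u /shift_zA //|u]; rewrite inE => /predU1P[->|/shift_sA //].
    by rewrite shift_mu opprD addrA subrr add0r ltrN10.
  by rewrite rk_cons_notin // exprS mulN1r addNr.
move=> a.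
have T0 : [set: 'I_m] != set0 by apply/set0Pn; exists f; rewrite inE.
pose zF := all (fun u => dot a u == 0) (edges V f F).
pose B := argmax_set (fun i => dot a (mu i)) (~: F).
have goodB : good B.
  rewrite /good argmax_set_neq0 //=.
  by apply/subsetP => i; rewrite inE => /andP[].
transitivity ((F \subset argmax_set (lin V a) setT)%:R : int).
  rewrite (eq_bigr (fun G => (G == argmax_set (lin V a) setT)%:R)); last first.
    move=> G /subsetP/(_ f fF') fG.
    by rewrite -/(normal_cone _ _ _ _ _) normal_cone_argmax ?subsetT.
  have [FM|FM] := boolP (F \subset argmax_set (lin V a) setT).
    rewrite (bigD1 (argmax_set (lin V a) setT)) //= eqxx big1 ?addr0 //.
    by move=> G /andP[_ /negPf ->].
  by rewrite big1 // => G FG; case: eqP => // e; rewrite -e FG in FM.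
rewrite -(pair_big good xpredT (fun A b => (cone (z' (A, b)) (s' (A, b)) a)%:R)) /=.
have coneA A : good A -> cone (zA A) (sA A) a = zF && (A == B).
  case/andP=> A0 AF; rewrite (eq_argmax_set _ AF (gP _ A0)) /cone all_cat -andbA.
  congr (_ && (_ && _)).
    apply/allP/forall_inP => h i; last first.
      by case/imageP => j jA ->; rewrite dotBr subr_eq0 h.
    by move=> iA; rewrite -subr_eq0 -dotBr h //; apply/imageP; exists i.
  apply/allP/forall_inP => h i; last first.
    by case/imageP => j jA ->; rewrite dotBr subr_lt0 h.
  by move=> iA; rewrite -subr_lt0 -dotBr h //; apply/imageP; exists i.
have coneAb A : good A -> \sum_b (cone (z' (A, b)) (s' (A, b)) a)%:R =
    [&& zF, A == B & (dot a (mu (g A)) <= 0)%R]%:R :> int.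
  move=> gA; rewrite big_bool /z' /s' /=.
  rewrite (_ : cone (_ :: _) _ _ = (dot a (mu (g A)) == 0) && cone (zA A) (sA A) a);
    last by rewrite /cone /= andbA.
  rewrite (_ : cone _ (_ :: _) _ = (dot a (mu (g A)) < 0) && cone (zA A) (sA A) a);
    last by rewrite /cone /= andbCA.
  rewrite coneA //.
  by case: (ltgtP (dot a (mu (g A))) 0); case: (zF); case: (A == B).
rewrite (eq_bigr _ coneAb) (bigD1 B) //= big1 ?addr0; last first.
  by move=> A /andP[_ /negPf ->]; rewrite andbF.
rewrite eqxx /=; congr ((_ : bool)%:R).
have gB : g B \in B by apply: gP; case/andP: goodB.
have gBF : g B \in ~: F by case/andP: goodB => _ /subsetP; apply.
apply/idP/andP => [/subsetP sub|[/allP z0 le0]].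
  have := sub f fF'; rewrite inE => /andP[_ /forall_inP hf]; split; last first.
    by rewrite mu_le0 // hf.
  apply/allP => u /edgesP[i iF ->]; rewrite dot_edge subr_eq0 eq_le hf //=.
  by have := sub i iF; rewrite inE => /andP[_ /forall_inP]; apply.
have lin_F i : i \in F -> lin V a i = lin V a f.
  by move=> iF; apply/eqP; rewrite -subr_eq0 -dot_edge z0 // mem_edges.
apply/subsetP => i iF; rewrite inE in_setT; apply/forall_inP => j _.
rewrite (lin_F i iF); have [/lin_F -> //|jF] := boolP (j \in F).
rewrite -mu_le0 ?inE //; apply: le_trans le0.
by move: gB; rewrite inE => /andP[_ /forall_inP]; apply; rewrite inE.
Qed.

End LocalEuler.

(** * Dehn-Sommerville equations of cubical polytopes *)

Section CubeFaces.
Variable k : nat.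
Implicit Types f g h : {ffun 'I_k -> option bool}.

Definition stars f : nat := #|[set j | f j == None]|.

Lemma cube_le_anti f g : cube_le f g -> cube_le g f -> f = g.
Proof.
move=> fg gf; apply/ffunP => j; case: (fg j) => // gj.
by case: (gf j) => // ->.
Qed.

Definition specialize f j0 : {ffun 'I_k -> option bool} :=
  [ffun j => if j == j0 then Some true else f j].

Lemma stars_specialize f j0 : f j0 = None -> stars f = (stars (specialize f j0)).+1.
Proof.
move=> fj; rewrite /stars (cardsD1 j0) inE fj eqxx; congr (_.+1).
by apply: eq_card => j; rewrite !inE ffunE; case: eqP => // ->.
Qed.

Lemma cube_le_specialize f j0 : f j0 = None -> cube_le (specialize f j0) f.
Proof. by move=> fj j; rewrite ffunE; case: eqP => [->|_]; [left|right]. Qed.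

Lemma specialize_cover f j0 h : f j0 = None ->
  cube_le (specialize f j0) h -> cube_le h f -> h = f \/ h = specialize f j0.
Proof.
move=> fj gh hf.
have other j : j != j0 -> h j = f j.
  move=> jj; case: (hf j) => // fn; case: (gh j) => -> //.
  by rewrite ffunE (negPf jj).
case: (gh j0) => hj0; [left|right]; apply/ffunP => j; rewrite ?ffunE.
  by have [->|/other //] := eqVneq j j0; rewrite hj0 fj.
by have [->|/other //] := eqVneq j j0; rewrite hj0 ffunE eqxx.
Qed.

(** Coordinates contribute independently: two fixed values of weight 1 and a free one of weight
    [x]. *)
Lemma sum_stars (A : comNzRingType) (x : A) :
  \sum_(f : {ffun 'I_k -> option bool}) x ^+ stars f = (2 + x) ^+ k.
Proof.
have -> : (2 + x) ^+ k = \prod_(i < k) \sum_(o : option bool) (if o == None then x else 1).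
  rewrite prodr_const card_ord; congr (_ ^+ _).
  rewrite (bigD1 None) //= (bigD1 (Some true)) //= (bigD1 (Some false)) //=.
  rewrite big1 => [|[[]|]] //; ring.
rewrite bigA_distr_bigA; apply: eq_bigr => f _.
rewrite -big_mkcond /= prodr_const; congr (_ ^+ _).
by apply: eq_card => j; rewrite inE.
Qed.

End CubeFaces.

Section CubicalFaces.
Variables (R : realType) (m n : nat) (V : 'M[R]_(m, n)) (S : {set 'I_m}).
Variables (k : nat) (phi : {ffun 'I_k -> option bool} -> {set 'I_m}).
Hypothesis phi_le : forall f g, cube_le f g <-> phi f \subset phi g.
Hypothesis phi_face : forall T, (is_face V S T /\ T != set0) <-> exists f, phi f = T.

Lemma cube_map_inj : injective phi.
Proof.
by move=> f g e; apply: cube_le_anti; apply/phi_le; rewrite e.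
Qed.

(** A combinatorial equivalence only respects inclusion, so dimensions must be recovered from the
    order. Passing to a facet of the cube lowers the dimension; a drop of two or more would leave
    room for an intermediate face, which the cube does not have. *)
Lemma affdim_cube_map f : affdim V (phi f) = stars f.
Proof.
have face f' : is_face V S (phi f') /\ phi f' != set0 by apply/phi_face; exists f'.
move e: (stars f) => s; elim: s => [|s IH] in f e *.
  apply/eqP; rewrite -leqn0 leqNgt; apply/negP => dpos.
  have [H [fH H0 HF]] := face_below (proj1 (face f)) (proj2 (face f)) dpos.
  have [h eh] : exists h, phi h = H by apply/phi_face.
  have hf : cube_le h f by apply/phi_le; rewrite eh; apply: proper_sub.
  suff fh : f = h by rewrite fh eh properxx in HF.
  apply: cube_le_anti => // j; right; case: (hf j) => // fj.
  move/eqP: e; rewrite cards_eq0 => /eqP/setP/(_ j).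
  by rewrite !inE fj eqxx.
have [j0 fj] : exists j0, f j0 = None.
  have : stars f != 0%N by rewrite e.
  by rewrite cards_eq0 => /set0Pn[j]; rewrite inE => /eqP; exists j.
have sg := stars_specialize fj; rewrite e in sg; case: sg => /esym sg.
set g := specialize f j0 in sg.
have gf : phi g \proper phi f.
  rewrite properEneq; apply/andP; split; last by apply/phi_le/cube_le_specialize.
  by apply/eqP => /cube_map_inj gf; move: e; rewrite -gf sg => /n_Sn.
have [[fg g0] [ff f0]] := (face g, face f).
have := affdim_lt fg g0 (face_sub ff) gf; rewrite (IH g sg) => lt1.
apply/eqP; rewrite eqn_leq lt1 andbT leqNgt; apply/negP => gt2.
have [|H [fH gH HF]] := face_between fg g0 ff gf; first by rewrite (IH g sg).
have [h eh] : exists h, phi h = H.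
  apply/phi_face; split=> //; apply: contraTneq gH => ->.
  by rewrite /proper subset0 (negPf g0).
have [] := @specialize_cover k f j0 h fj.
- by apply/phi_le; rewrite eh proper_sub.
- by apply/phi_le; rewrite eh proper_sub.
- by move=> e'; rewrite -eh e' properxx in HF.
- by move=> e'; rewrite -eh e' properxx in gH.
Qed.

Lemma sum_cube_map_faces (A : comNzRingType) (x : A) : S != set0 ->
  \sum_(T | `[< is_face V S T >] && (T != set0)) x ^+ affdim V T =
  (2 + x) ^+ affdim V S.
Proof.
move=> S0; have [f0 ef0] : exists f, phi f = S.
  by apply/phi_face; split=> //; apply: face_refl.
have -> : affdim V S = k.
  pose top : {ffun 'I_k -> option bool} := [ffun=> None].
  have f0top : cube_le f0 top by move=> j; left; rewrite ffunE.
  have topf0 : cube_le top f0.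
    apply/phi_le; rewrite ef0.
    have [/face_sub //] : is_face V S (phi top) /\ phi top != set0.
    by apply/phi_face; exists top.
  rewrite -ef0 affdim_cube_map (cube_le_anti f0top topf0) /stars -[RHS]card_ord.
  by apply: eq_card => j; rewrite !inE ffunE.
rewrite -sum_stars (eq_bigr (fun f => x ^+ affdim V (phi f))); last first.
  by move=> f _; rewrite affdim_cube_map.
rewrite -(big_imset (A := predT) (h := phi) (fun T => x ^+ affdim V T)) /=; last first.
  by move=> f g _ _; apply: cube_map_inj.
apply: eq_bigl => T; apply/andP/imsetP => [[/asboolP fT T0]|[f _ ->]].
  by have [f ef] : exists f, phi f = T; [apply/phi_face|exists f].
have [? ?] : is_face V S (phi f) /\ phi f != set0 by apply/phi_face; exists f.
by split=> //; apply/asboolP.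
Qed.

End CubicalFaces.

(** * The h-numbers of a cubical polytope and their symmetry *)

Section DehnSommerville.
Variables (R : realType) (d m : nat) (V : 'M[R]_(m, d.+1)).
Hypothesis Vdim : affdim V setT = d.+1.
Implicit Types G T : {set 'I_m}.

Definition proper_face G : bool :=
  [&& `[< is_face V setT G >], G != set0 & G != setT].

Lemma points_neq0 : [set: 'I_m] != set0.
Proof.
by apply/eqP => e; move: Vdim; rewrite /affdim; case: pickP => // i; rewrite e inE.
Qed.

Lemma sum_proper_face (phi : nat -> int) :
  \sum_(G | proper_face G) phi (affdim V G) = \sum_(j < d.+1) fvec V 0 j * phi j.
Proof.
have lt_d G : proper_face G -> (affdim V G < d.+1)%N.
  case/and3P=> /asboolP fG G0 GT; rewrite -[X in (_ < X)%N]Vdim.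
  by apply: affdim_lt fG G0 (subsetT _) _; rewrite properT.
rewrite (partition_big (fun G => inord (affdim V G) : 'I_d.+1) xpredT) //=.
apply: eq_bigr => j _.
rewrite (eq_bigr (fun=> phi j)); last first.
  by move=> G /andP[/lt_d h /eqP <-]; rewrite inordK.
rewrite sumr_const mxE -mulr_natl natz; congr (_%:Z * _).
apply: eq_card => G; rewrite !inE unfold_in -andbA.
apply/andP/and3P => [[pG /eqP <-]|[fG G0 /eqP dG]].
  by case/and3P: (pG) => -> -> _; rewrite inordK ?lt_d.
split; last by rewrite dG inord_val.
rewrite /proper_face fG G0 /=; apply: contra_eq_neq dG => ->.
by rewrite Vdim gtn_eqF.
Qed.

(** The coefficient of X^k in f(-1-X), where f has coefficient vector [x]. *)
Definition hvec (x : 'rV[int]_d.+1) (k : nat) : int :=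
  \sum_(j < d.+1) x 0 j * ((-1) ^+ j * 'C(j, k)%:R).

Lemma hvec_fvec k :
  hvec (fvec V) k = \sum_(G | proper_face G) (-1) ^+ affdim V G * 'C(affdim V G, k)%:R.
Proof. by rewrite (sum_proper_face (fun j => (-1) ^+ j * 'C(j, k)%:R)). Qed.

(** Euler's relation with the term of the whole polytope, (-1)^(d+1), moved to the other side. *)
Lemma hvec0_fvec : hvec (fvec V) 0 = 1 + (-1) ^+ d.
Proof.
rewrite hvec_fvec; under eq_bigr do rewrite bin0 mulr1.
have m0 : (0 < m)%N.
  by have /set0Pn[i _] := points_neq0; apply: leq_ltn_trans (ltn_ord i).
have := euler_relation V m0; rewrite (bigD1 [set: 'I_m]) /=; last first.
  by rewrite points_neq0 andbT; apply/asboolP/face_refl.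
rewrite Vdim exprS mulN1r addrC => /eqP; rewrite subr_eq => /eqP <-.
by apply: eq_bigl => G; rewrite /proper_face -andbA.
Qed.

Lemma coef_oneD_X_exp j k : (((1 + 'X) ^+ j : {poly int})`_k) = 'C(j, k)%:R.
Proof.
rewrite addrC exprD1n coef_sum.
under eq_bigr do rewrite coefMn coefXn.
have [kj|kj] := leqP k j.
  rewrite (bigD1 (Ordinal (kj : (k < j.+1)%N))) //= eqxx big1 ?addr0 //.
  by move=> i /eqP h; case: eqP => // e; rewrite ?mul0rn //; case: h; apply: val_inj.
rewrite bin_small // big1 // => i _; case: eqP => [e|_]; last by rewrite mul0rn.
by move: kj; rewrite e ltnNge -ltnS ltn_ord.
Qed.

Lemma coef_comp_polyN (p : {poly int}) k : (p \Po (- 'X))`_k = (-1) ^+ k * p`_k.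
Proof.
have powN i : (- 'X : {poly int}) ^+ i = (-1) ^+ i *: 'X^i.
  elim: i => [|i IH]; first by rewrite !expr0 scale1r.
  by rewrite !exprS IH mulN1r scaleNr mulNr scalerAr.
rewrite comp_polyE coef_sum; under eq_bigr do rewrite powN !coefZ coefXn.
have [kp|kp] := ltnP k (size p); last first.
  rewrite [p`_k]nth_default // mulr0 big1 // => i _.
  by rewrite gtn_eqF ?mulr0 //; apply: leq_trans kp.
rewrite (bigD1 (Ordinal kp)) //= eqxx big1 ?addr0; last first.
  by move=> i /eqP h; case: eqP => [e|_]; rewrite ?mulr0 //; case: h; apply: val_inj.
by rewrite mulr1 mulrC.
Qed.

(* With [h = \sum_k h_k X^k = \sum_G (-(1 + X)) ^ (dim G)], the sum running over
   proper faces, the equations say [h(X) = (-1)^d h(-X)]; both sides count the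
   pairs of faces [T \subset G] with sign [(-1)^(dim G)] and weight
   [(X - 1)^(dim T)]. *)
Lemma dehn_sommerville k : cubical V -> odd k != odd d -> hvec (fvec V) k = 0.
Proof.
move=> Vcub kd; pose h : {poly int} := \sum_(G | proper_face G) (- (1 + 'X)) ^+ affdim V G.
have hk : hvec (fvec V) k = h`_k.
  rewrite hvec_fvec coef_sum; apply: eq_bigr => G _.
  rewrite [in RHS]exprNn -[in LHS]signr_odd -[in RHS]signr_odd.
  by case: odd; rewrite ?expr1 ?expr0 ?mulN1r ?mul1r ?coefN coef_oneD_X_exp.
have sym : h = (-1) ^+ d * (h \Po (- 'X)).
  transitivity (\sum_(G | proper_face G) \sum_(T | proper_face T && (T \subset G))
      (-1) ^+ affdim V G * ('X - 1) ^+ affdim V T : {poly int}).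
    apply: eq_bigr => G /and3P[/asboolP fG G0 GT].
    rewrite -mulr_sumr [in LHS]exprNn. congr (_ * _).
    have [k' [phi [phi_le phi_face]]] := Vcub G fG G0 GT.
    (* Cubicality enters here: (2 + (X - 1))^(dim G) is the sum of (X - 1)^(dim T) over the nonempty
       faces T of the cube G. *)
    rewrite (_ : 1 + 'X = 2 + ('X - 1)); last by ring.
    rewrite -(sum_cube_map_faces phi_le phi_face) //; apply: eq_bigl => T.
    rewrite /proper_face; apply/andP/andP => [[/asboolP fT T0]|[/and3P[/asboolP fT T0 _] TG]].
      have TG := face_sub fT; rewrite TG T0; split=> //; apply/and3P; split=> //.
        by apply/asboolP; apply: face_trans fG fT T0.
      by apply: contraNneq GT => TT; rewrite -subTset -TT.
    by split=> //; apply/asboolP; apply: face_restrict fT; rewrite ?subsetT.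
  rewrite (exchange_big_dep proper_face) /=; last by move=> ? ? _ /andP[].
  rewrite /h (raddf_sum (comp_poly (- 'X))) mulr_sumr; apply: eq_bigr => T pT.
  case/and3P: (pT) => /asboolP fT T0 TT.
  rewrite -mulr_suml /=; congr (_ * _); last first.
    rewrite rmorphXn /= rmorphN rmorphD rmorph1 /= comp_polyX; congr (_ ^+ _).
    by ring.
  have /(congr1 (fun x : int => x%:~R : {poly int})) :
      \sum_(G | proper_face G && (T \subset G)) (-1) ^+ affdim V G = (-1)%R ^+ d :> int.
    have := local_euler_relation fT T0 TT; rewrite (bigD1 [set: 'I_m]) /=; last first.
      by rewrite subsetT andbT; apply/asboolP/face_refl.
    rewrite Vdim exprS mulN1r addrC => /eqP; rewrite subr_eq0 => /eqP <-.
    apply: eq_bigl => G; rewrite /proper_face.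
    have [TG|] := boolP (T \subset G); last by rewrite !andbF.
    suff -> : G != set0 by rewrite !andbT.
    by apply: contraNneq T0 => G0; rewrite -subset0 -G0.
  rewrite rmorph_sum rmorph_sign => <-; apply: eq_big => G; first by rewrite pT.
  by rewrite rmorph_sign.
(* When the parities of k and d differ, this says that the coefficient is its own negative. *)
have e : h`_k = (-1) ^+ d * ((-1) ^+ k * h`_k).
  rewrite -coef_comp_polyN {1}sym -[in LHS]signr_odd -[in RHS]signr_odd.
  by case: odd; rewrite ?expr1 ?expr0 ?mulN1r ?mul1r ?coefN.
move: e; rewrite hk mulrA -exprD -signr_odd oddD.
by rewrite (_ : odd d (+) odd k = true) ?expr1 ?mulN1r; [lia|case: odd kd; case: odd].
Qed.

End DehnSommerville.

(** * Cubical zonotopes *)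

Section FaceArgmax.
Variables (R : realType) (m n : nat) (V : 'M[R]_(m, n)).

Lemma face_argmaxP D T : D != set0 ->
  (is_face V D T /\ T != set0) <-> exists a, T = argmax_set (lin V a) D.
Proof.
move=> D0; split=> [[fT /set0Pn[g gT]]|[a ->]]; last first.
  by split; [exact: argmax_face|exact: argmax_set_neq0].
have /(faceP _ _ gT)[TD [a]] := fT.
by rewrite normal_cone_argmax // => /eqP ->; exists a.
Qed.

End FaceArgmax.

Section Zonotope.
Variables (R : realType) (d N : nat).
Hypothesis dN : (d < N)%N.
Implicit Types (a b : 'rV[R]_d.+1) (P Z A : {set 'I_N}) (i j : 'I_N).

(** Pairing with [moment i] evaluates a polynomial of degree at most d at [i], so general position
    becomes root counting and Lagrange interpolation. *)
Definition moment i : 'rV[R]_d.+1 := \row_j i%:R ^+ j.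

Lemma dot_moment a i : dot a (moment i) = (rVpoly a).[i%:R].
Proof.
rewrite /rVpoly horner_poly; apply: eq_bigr => j _; rewrite mxE.
by rewrite insubT // => h; congr (a _ _ * _); apply: val_inj.
Qed.

Lemma natr_ord_inj : injective (fun i : 'I_N => (i%:R : R)).
Proof. by move=> i j /eqP; rewrite eqr_nat => /eqP/val_inj. Qed.

Definition zero_set a : {set 'I_N} := [set i | dot a (moment i) == 0].
Definition pos_set a : {set 'I_N} := [set i | 0 < dot a (moment i)].

Lemma card_zero_set a : a != 0 -> (#|zero_set a| <= d)%N.
Proof.
move=> a0; pose s := [seq (i%:R : R) | i : 'I_N in zero_set a].
have p0 : rVpoly a != 0.
  by apply: contraNneq a0 => e; rewrite -[a]rVpolyK e linear0.
have := max_poly_roots (rs := s) p0.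
rewrite size_map -cardE => h; rewrite -ltnS.
apply: leq_trans (h _ _) (size_poly _ _).
  by apply/allP => x /imageP[i]; rewrite inE => /eqP e ->; rewrite /root -dot_moment e.
by rewrite map_inj_uniq ?enum_uniq //; apply: natr_ord_inj.
Qed.

Lemma moment_dual Z i : (#|Z| <= d.+1)%N -> i \in Z ->
  exists a, dot a (moment i) = 1 /\ forall j, j \in Z -> j != i -> dot a (moment j) = 0.
Proof.
move=> Zd iZ; pose L : {poly R} := \prod_(j in Z :\ i) ('X - j%:R%:P).
have Li : L.[i%:R] != 0.
  rewrite horner_prod prodf_seq_neq0; apply/allP => j _; apply/implyP.
  rewrite !inE => /andP[ji _]; rewrite hornerXsubC subr_eq0.
  by apply: contraNneq ji => /natr_ord_inj ->.
have sL : (size L <= d.+1)%N.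
  by rewrite /L -big_enum size_prod_XsubC -cardE; move: Zd; rewrite (cardsD1 i) iZ.
exists ((L.[i%:R])^-1 *: poly_rV L); split=> [|j jZ ji]; rewrite dotZl dot_moment poly_rV_K //.
  by rewrite mulVf.
suff -> : L.[j%:R] = 0 by rewrite mulr0.
rewrite horner_prod (bigD1 j) /=; last by rewrite !inE ji.
by rewrite hornerXsubC subrr mul0r.
Qed.

Lemma moment_interpolation Z (x : 'I_N -> R) : (#|Z| <= d.+1)%N ->
  exists a, forall j, j \in Z -> dot a (moment j) = x j.
Proof.
move=> Zd.
have [e he] : exists e : 'I_N -> 'rV[R]_d.+1, forall i, i \in Z ->
    forall j, j \in Z -> dot (e i) (moment j) = (j == i)%:R.
  have /choice : forall i, exists a, i \in Z -> forall j, j \in Z -> dot a (moment j) = (j == i)%:R.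
    move=> i; have [iZ|_] := boolP (i \in Z); last by exists 0.
    have [a [a1 a0]] := moment_dual Zd iZ; exists a => _ j jZ.
    by have [->|/a0->] := eqVneq j i.
  by case=> e he; exists e.
exists (\sum_(i in Z) x i *: e i) => j jZ.
rewrite dotC dot_sumr (bigD1 j) //= big1 ?addr0 => [|i /andP[iZ ij]].
  by rewrite dotZr dotC he // eqxx mulr1.
by rewrite dotZr dotC he // eq_sym (negPf ij) mulr0.
Qed.

Lemma rk_moment Z : (#|Z| <= d.+1)%N -> rk [seq moment i | i in Z] = #|Z|.
Proof.
rewrite cardE /image_mem; move: (enum_uniq Z); elim: (enum Z) => [|i s IH] /=.
  by rewrite /rk /= mxrank0.
move=> /andP[iS us] sd; rewrite rk_cons_notin ?IH //; first exact: ltnW.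
have [||a [a1 a0]] := @moment_dual [set j in i :: s] i.
- by rewrite cardsE; apply: leq_trans sd; apply: card_size.
- by rewrite !inE eqxx.
apply/negP => hi; suff /eqP : dot a (moment i) = 0 by rewrite a1 oner_eq0.
apply: (dot_span_mx _ hi) => w /mapP[j js ->]; apply: a0; first by rewrite !inE js orbT.
by apply: contraNneq iS => <-.
Qed.

Local Notation vertices := 'I_#|{set 'I_N}|.
Definition point (p : vertices) : {set 'I_N} := enum_val p.
Definition index A : vertices := enum_rank A.

Lemma indexK A : point (index A) = A. Proof. exact: enum_rankK. Qed.

(** All subset sums of the generators are listed, vertices or not: the index set of a nonempty face
    is then an interval of the Boolean lattice, a [box]. *)
Definition zonotope : 'M[R]_(#|{set 'I_N}|, d.+1) :=
  \matrix_(p, j) (\sum_(i in point p) moment i) 0 j.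
Local Notation V := zonotope.

Lemma row_zonotope p : row p V = \sum_(i in point p) moment i.
Proof. by apply/rowP => j; rewrite !mxE. Qed.

Lemma lin_zonotope a p : lin V a p = \sum_(i in point p) dot a (moment i).
Proof. by rewrite lin_dot row_zonotope dot_sumr. Qed.

Definition box P Z : {set vertices} :=
  [set p | (P \subset point p) && (point p \subset P :|: Z)].

Lemma mem_box P Z A : (index A \in box P Z) = (P \subset A) && (A \subset P :|: Z).
Proof. by rewrite inE indexK. Qed.

Lemma box_neq0 P Z : box P Z != set0.
Proof. by apply/set0Pn; exists (index P); rewrite mem_box subxx subsetUl. Qed.

Lemma box_setT : box set0 setT = setT.
Proof. by apply/setP => p; rewrite !inE sub0set setUT subsetT. Qed.

Lemma box_subset P Z P' Z' :
  (box P Z \subset box P' Z') = (P' \subset P) && (P :|: Z \subset P' :|: Z').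
Proof.
apply/subsetP/andP => [h|[h1 h2] p].
  have := h (index P); have := h (index (P :|: Z)).
  by rewrite !mem_box !subxx !subsetUl => /(_ isT)/andP[_ ?] /(_ isT)/andP[? _].
by rewrite !inE => /andP[k1 k2]; rewrite (subset_trans h1 k1) (subset_trans k2 h2).
Qed.

(** A subset sum is maximised one generator at a time: positive values are taken, negative ones
    dropped, and zeros leave the choice free. *)
Lemma argmax_box b P Z : [disjoint P & Z] ->
  argmax_set (lin V b) (box P Z) = box (P :|: (Z :&: pos_set b)) (Z :&: zero_set b).
Proof.
move=> PZ; set P' := P :|: _; set Z' := _ :&: zero_set b.
have P'box : index P' \in box P Z.
  by rewrite mem_box subsetUl /= subUset subsetUl subIset // subsetUr.
pose x i := dot b (moment i).
(* The loss of [A] at generator [i] against the optimal subset [P']. Losses are nonnegative on the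
   box, so their sum vanishes only if each one does. *)
pose y (A : {set 'I_N}) i := ((i \in P')%:R - (i \in A)%:R) * x i.
have sumy p : lin V b (index P') - lin V b p = \sum_i y (point p) i.
  rewrite !lin_zonotope indexK big_mkcond [X in _ - X]big_mkcond -sumrB.
  by apply: eq_bigr => i _; rewrite /y; case: (i \in P'); case: (i \in point p);
    rewrite ?subrr ?subr0 ?sub0r ?mul0r ?mul1r ?mulN1r.
have yE p i : p \in box P Z ->
    y (point p) i = if i \in Z then ((0 < x i)%R%:R - (i \in point p)%:R) * x i else 0.
  rewrite inE => /andP[/subsetP/(_ i) sub1 /subsetP/(_ i)]; rewrite /y !inE -/(x i) => sub2.
  have [iZ|iZ] := boolP (i \in Z).
    by rewrite (disjointFl PZ iZ).
  move: sub1 sub2; rewrite (negPf iZ) !orbF.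
  case: (i \in P); first by move=> ->; rewrite // subrr mul0r.
  by case: (i \in point p) => _; [move/(_ isT)|rewrite subrr mul0r].
have gap_ge0 (r : R) (c : bool) : 0 <= ((0 < r)%R%:R - c%:R) * r.
  by case: c; case: (ltgtP r 0) => h /=; lra.
have gap_eq0 (r : R) (c : bool) :
    (((0 < r)%R%:R - c%:R) * r == 0) = ((0 < r) ==> c) && (c ==> (0 <= r)).
  case: c; case: (ltgtP r 0) => h /=; rewrite ?subrr ?mul0r ?eqxx //;
    by apply/eqP; lra.
have y_ge0 p i : p \in box P Z -> 0 <= y (point p) i.
  by move/yE => ->; case: ifP.
have y_eq0 p : p \in box P Z -> (forall i, y (point p) i = 0) <-> p \in box P' Z'.
  move=> pbox; have := pbox; rewrite !inE => /andP[/subsetP PA /subsetP APZ].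
  split=> [h|/andP[/subsetP h1 /subsetP h2] i].
    have gap i : i \in Z -> ((0 < x i) ==> (i \in point p)) && ((i \in point p) ==> (0 <= x i)).
      by move=> iZ; rewrite -gap_eq0; have := h i; rewrite yE // iZ => ->.
    apply/andP; split; apply/subsetP => i.
      rewrite !inE => /orP[/PA //|/andP[/gap/andP[/implyP h1 _]]]; exact: h1.
    move=> iA; have := APZ i iA; rewrite !inE => /orP[->//|iZ].
    have /andP[_ /implyP/(_ iA)] := gap i iZ; rewrite iZ le_eqVlt eq_sym -/(x i).
    by case/orP=> ->; rewrite !orbT.
  rewrite yE //; case: ifP => // iZ; apply/eqP; rewrite gap_eq0.
  have := h1 i; have := h2 i; rewrite !inE iZ (disjointFl PZ iZ) /= -/(x i) => k1 k2.
  apply/andP; split; first exact/implyP.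
  by apply/implyP => /k1/orP[/ltW //|/eqP ->].
have lin_max p : p \in box P Z -> (lin V b p <= lin V b (index P')) /\
    ((lin V b p == lin V b (index P')) = (p \in box P' Z')).
  move=> pbox; rewrite -subr_ge0 sumy; split; first by apply: sumr_ge0 => i _; apply: y_ge0.
  rewrite eq_sym -subr_eq0 sumy; apply/eqP/idP => [h|/(y_eq0 p pbox) h]; last exact: big1.
  apply/(y_eq0 p pbox) => i; apply: (psumr_eq0P _ h) => // k _; exact: y_ge0.
have subbox : box P' Z' \subset box P Z.
  rewrite box_subset subsetUl -setUA -setIUr setUSS ?subsetIl //.
apply/eqP; rewrite eq_sym (eq_argmax_set _ subbox (j := index P')).
  apply/andP; split; apply/forall_inP => p.
    by move=> pb; rewrite (proj2 (lin_max p (subsetP subbox p pb))).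
  rewrite inE => /andP[pb pbox]; have [h1 h2] := lin_max p pbox.
  by rewrite lt_neqAle h1 h2 pb.
by rewrite mem_box subxx subsetUl.
Qed.

Lemma zonotope_faceP T :
  (is_face V setT T /\ T != set0) <-> exists a, T = box (pos_set a) (zero_set a).
Proof.
rewrite face_argmaxP -?box_setT ?box_neq0 //.
have E a : argmax_set (lin V a) (box set0 setT) = box (pos_set a) (zero_set a).
  by rewrite argmax_box ?set0U ?setTI // -setI_eq0 set0I.
by split=> -[a ->]; exists a; rewrite E.
Qed.

Lemma disjoint_pos_zero a : [disjoint pos_set a & zero_set a].
Proof.
rewrite -setI_eq0; apply/eqP/setP => i; rewrite !inE.
by apply/negP => /andP[h /eqP e]; rewrite e ltxx in h.
Qed.

(** Adding one generator of [Z] to [P] gives an edge equal to that generator, and every edge from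
    [P] is a sum of these. *)
Lemma affdim_box P Z : [disjoint P & Z] ->
  affdim V (box P Z) = rk [seq moment i | i in Z].
Proof.
move=> PZ; have gP : index P \in box P Z by rewrite mem_box subxx subsetUl.
rewrite (affdim_rk V gP); apply/eqP; rewrite eqn_leq; apply/andP; split; apply: mxrankS.
  rewrite span_mx_sub; apply/allP => u /edgesP[p]; rewrite inE => /andP[PA AZ] ->.
  rewrite /edge !row_zonotope indexK (big_setID P) /= (setIidPr PA) addrAC subrr add0r.
  apply: summx_sub => i; rewrite inE => /andP[iP iA]; apply: mem_span_mx.
  apply/imageP; exists i => //; have := subsetP AZ i iA; rewrite inE (negPf iP); exact.
rewrite span_mx_sub; apply/allP => u /imageP[i iZ ->]; apply: mem_span_mx.
apply/edgesP; exists (index (i |: P)).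
  by rewrite mem_box subsetUr setUC setUS // sub1set.
by rewrite /edge !row_zonotope !indexK big_setU1 ?addrK //= (disjointFl PZ iZ).
Qed.

Lemma affdim_zonotope : affdim V setT = d.+1.
Proof.
rewrite -box_setT affdim_box; last by rewrite -setI_eq0 set0I.
apply/eqP; rewrite eqn_leq rank_leq_row /=.
pose Z : {set 'I_N} := [set widen_ord dN i | i : 'I_d.+1].
have cZ : #|Z| = d.+1 by rewrite card_imset ?card_ord // => i j /(congr1 val) /= e; apply: val_inj.
apply: (@leq_trans (rk [seq moment i | i in Z])); first by rewrite rk_moment cZ.
apply/mxrankS/span_mx_mono => u.
by case/imageP => i _ ->; apply/imageP; exists i.
Qed.

Definition cube_pos P Z (f : {ffun 'I_#|Z| -> option bool}) : {set 'I_N} :=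
  P :|: [set enum_val j | j in [pred j | f j == Some true]].
Definition cube_zero Z (f : {ffun 'I_#|Z| -> option bool}) : {set 'I_N} :=
  [set enum_val j | j in [pred j | f j == None]].

Lemma mem_cube_pos P Z f (j : 'I_#|Z|) : [disjoint P & Z] ->
  (enum_val j \in cube_pos P f) = (f j == Some true).
Proof.
move=> PZ; rewrite inE (disjointFl PZ (enum_valP j)) /= mem_imset //.
exact: enum_val_inj.
Qed.

Lemma mem_cube_zero Z f (j : 'I_#|Z|) :
  (enum_val j \in cube_zero f) = (f j == None).
Proof. by rewrite mem_imset //; exact: enum_val_inj. Qed.

Lemma cube_set_sub P Z f (i : 'I_N) : i \in cube_pos P f :|: @cube_zero Z f ->
  i \in P \/ exists2 j, i = enum_val j & f j != Some false.
Proof.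
rewrite !inE => /orP[/orP[|/imsetP[j]]|/imsetP[j]]; first by left.
  by rewrite inE => /eqP e ->; right; exists j; rewrite ?e.
by rewrite inE => /eqP e ->; right; exists j; rewrite ?e.
Qed.

Lemma mem_cube_set P Z f (j : 'I_#|Z|) : [disjoint P & Z] ->
  (enum_val j \in cube_pos P f :|: cube_zero f) = (f j != Some false).
Proof.
by move=> PZ; rewrite in_setU mem_cube_pos // mem_cube_zero; case: (f j) => [[]|].
Qed.

Lemma sub_cube_pos P Z (f : {ffun 'I_#|Z| -> option bool}) : P \subset cube_pos P f.
Proof. exact: subsetUl. Qed.

Lemma cube_le_box P Z (f g : {ffun 'I_#|Z| -> option bool}) : [disjoint P & Z] ->
  cube_le f g <->
  box (cube_pos P f) (cube_zero f) \subset box (cube_pos P g) (cube_zero g).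
Proof.
move=> PZ; rewrite box_subset; split=> [h|/andP[/subsetP h1 /subsetP h2] j].
  apply/andP; split; apply/subsetP => i.
    rewrite inE => /orP[/(subsetP (sub_cube_pos P f)) //|/imsetP[j]].
    rewrite inE => /eqP e ->; rewrite mem_cube_pos //.
    by move: e; case: (h j) => -> // ->.
  case/cube_set_sub => [iP|[j -> fj]].
    by rewrite in_setU (subsetP (sub_cube_pos P g)).
  by rewrite mem_cube_set //; case: (h j) => ->.
have := h1 (enum_val j); have := h2 (enum_val j).
rewrite !mem_cube_set // !mem_cube_pos //.
case: (f j) (g j) => [[]|] [[]|] //=; try by [left|right].
- by move=> /(_ isT).
- by move=> _ /(_ isT).
- by move=> _ /(_ isT).
- by move=> /(_ isT).
Qed.

(** A nonzero functional vanishes on at most d generators. By interpolation every sign pattern on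
    these is realised by some functional, and the sign patterns are the elements of {0,1,*}^Z. *)
Lemma cubical_zonotope : cubical V.
Proof.
move=> S fS S0 ST; have [a eS] : exists a, S = box (pos_set a) (zero_set a).
  exact/zonotope_faceP.
have a0 : a != 0.
  apply: contraNneq ST => e; rewrite eS -subTset -box_setT box_subset.
  apply/andP; split; apply/subsetP => i; rewrite !inE e dot0l ?ltxx //.
  by rewrite eqxx orbT.
set P := pos_set a in eS; set Z := zero_set a in eS.
have PZ : [disjoint P & Z] := disjoint_pos_zero a.
have Zd : (#|Z| <= d.+1)%N by apply: leqW; apply: card_zero_set.
clearbody P Z.
exists #|Z|, (fun f => box (cube_pos P f) (cube_zero f)); split.
  by move=> f g; apply: cube_le_box.
pose sgn_fun b : {ffun 'I_#|Z| -> option bool} :=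
  [ffun j => if dot b (moment (enum_val j)) == 0 then None
             else Some (0 < dot b (moment (enum_val j)))].
have box_sgn b : argmax_set (lin V b) S = box (cube_pos P (sgn_fun b)) (cube_zero (sgn_fun b)).
  rewrite eS argmax_box //; congr (box (P :|: _) _); apply/setP => i.
    rewrite !inE; apply/andP/imsetP => [[iZ xi]|[j jf ->]].
      exists (enum_rank_in iZ i); last by rewrite enum_rankK_in.
      by rewrite inE ffunE enum_rankK_in // xi gt_eqF.
    by move: jf; rewrite inE ffunE enum_valP; case: ifP => // _ /eqP[->].
  rewrite !inE; apply/andP/imsetP => [[iZ xi]|[j jf ->]].
    exists (enum_rank_in iZ i); last by rewrite enum_rankK_in.
    by rewrite inE ffunE enum_rankK_in // xi.
  by move: jf; rewrite inE ffunE enum_valP; case: ifP.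
move=> T; rewrite face_argmaxP //; split=> [[b ->]|[f <-]].
  by exists (sgn_fun b); rewrite box_sgn.
(* [enum_rank_in] needs an element of [Z]; for empty [Z] there is only one [f]. *)
have [z0 | /set0Pn[i0 i0Z]] := eqVneq Z set0.
  exists 0; rewrite box_sgn; suff -> : sgn_fun 0 = f by [].
  by apply/ffunP => -[j hj]; exfalso; move: hj; rewrite z0 cards0.
pose x i : R := match f (enum_rank_in i0Z i) with
  | None => 0 | Some true => 1 | Some false => -1 end.
have [b hb] := moment_interpolation x Zd.
exists b; rewrite box_sgn; suff -> : sgn_fun b = f by [].
apply/ffunP => j; rewrite ffunE hb ?enum_valP // /x enum_valK_in.
by case: (f j) => [[]|]; rewrite ?eqxx ?oner_eq0 ?oppr_eq0 ?oner_eq0 ?ltr01 ?oppr_gt0 ?ltr10.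
Qed.

(** Reads [Z] off the index set of a box, so that sums over faces need no chosen functional. *)
Definition free_set (G : {set vertices}) : {set 'I_N} :=
  [set i | [exists p in G, i \in point p] && [exists p in G, i \notin point p]].

Lemma free_set_box P Z : [disjoint P & Z] -> free_set (box P Z) = Z.
Proof.
move=> PZ; apply/setP => i; rewrite inE; apply/andP/idP => [[]|iZ].
  move=> /exists_inP[p]; rewrite inE => /andP[_ /subsetP h1] ip.
  move=> /exists_inP[q]; rewrite inE => /andP[/subsetP h2 _] iq.
  have := h1 i ip; rewrite inE => /orP[/h2|//]; by rewrite (negPf iq).
split; apply/exists_inP.
  exists (index (P :|: Z)); first by rewrite mem_box subsetUl subxx.
  by rewrite indexK inE iZ orbT.
exists (index P); first by rewrite mem_box subsetUl subxx.
by rewrite indexK (disjointFl PZ iZ).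
Qed.

(** The normal cones of all faces, the whole polytope included, that have [Z] among their free
    generators partition the space of functionals vanishing on [Z], of codimension #|Z|. Removing
    the whole polytope produces (-1)^d. *)
Lemma sum_faces_containing Z : (#|Z| <= d)%N ->
  \sum_(G | proper_face V G && (Z \subset free_set G)) (-1) ^+ affdim V G =
  (-1) ^+ #|Z| + (-1) ^+ d :> int.
Proof.
move=> Zd; pose p0 := index set0; pose g (G : {set vertices}) := odflt p0 [pick p in G].
have gP G : G != set0 -> g G \in G.
  by case/set0Pn => i iG; rewrite /g; case: pickP => //= /(_ i); rewrite iG.
have T0 : [set: vertices] != set0 by apply/set0Pn; exists p0; rewrite inE.
have total : \sum_(G | `[< is_face V setT G >] && ((G != set0) && (Z \subset free_set G)))
    (-1) ^+ affdim V G = (-1) ^+ #|Z| :> int.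
  transitivity (\sum_(G | (G != set0) && (Z \subset free_set G))
      eul (edges V (g G) G) (edges V (g G) (setT :\: G))).
    rewrite big_mkcondl; apply: eq_bigr => G /andP[/gP gG _].
    by rewrite eul_normal_cone // subsetT.
  rewrite (@eul_sum_eq _ _ _ unit _ xpredT _ _ (fun=> [seq moment i | i in Z]) (fun=> [::])).
    rewrite big_const card_unit /= addr0 (@eul_nonempty _ _ _ _ 0).
      by rewrite rk_moment // leqW.
    by apply/coneP; split=> // u _; rewrite dot0l.
  move=> a; rewrite [RHS]big_const card_unit /= addr0.
  rewrite (eq_bigr (fun G => (G == argmax_set (lin V a) setT)%:R)); last first.
    move=> G /andP[/gP gG _].
    by rewrite -/(normal_cone _ _ _ _ _) normal_cone_argmax ?subsetT.
  have -> : cone [seq moment i | i in Z] [::] a = (Z \subset zero_set a).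
    rewrite /cone andbT; apply/allP/subsetP => [h i iZ|h u /imageP[i /h]].
      by rewrite inE h //; apply/imageP; exists i.
    by rewrite inE => ? ->.
  have fa : free_set (argmax_set (lin V a) setT) = zero_set a.
    rewrite -box_setT argmax_box ?set0U ?setTI ?free_set_box ?disjoint_pos_zero //.
    by rewrite -setI_eq0 set0I.
  have [ZM|ZM] := boolP (Z \subset zero_set a).
    rewrite (bigD1 (argmax_set (lin V a) setT)) /= ?fa ?ZM ?argmax_set_neq0 // eqxx big1 ?addr0 //.
    by move=> G /andP[_ /negPf ->].
  rewrite big1 // => G /andP[_ ZG]; case: eqP => // e.
  by move: ZM; rewrite -fa -e ZG.
move: total; rewrite (bigD1 [set: vertices]) /=; last first.
  have -> : free_set setT = setT.
    by rewrite -{1}box_setT free_set_box // -setI_eq0 set0I.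
  by rewrite T0 subsetT /= andbT; apply/asboolP/face_refl.
rewrite affdim_zonotope exprS mulN1r addrC => /eqP; rewrite subr_eq => /eqP <-.
apply: eq_bigl => G; rewrite /proper_face.
by case: (G != set0); case: (G != setT); case: (Z \subset _); rewrite ?andbT ?andbF.
Qed.

(** Properness leaves at most d free generators, hence independent ones; the whole polytope has N of
    them in dimension d+1. *)
Lemma affdim_free_set G : proper_face V G -> #|free_set G| = affdim V G.
Proof.
case/and3P => /asboolP fG G0 GT.
have [a eG] : exists a, G = box (pos_set a) (zero_set a) by apply/zonotope_faceP.
have PZ := disjoint_pos_zero a; rewrite eG free_set_box // affdim_box // rk_moment //.
apply: leqW; apply: card_zero_set; apply: contraNneq GT => e.
rewrite eG -subTset -box_setT box_subset.
by apply/andP; split; apply/subsetP => i; rewrite !inE e dot0l ?ltxx // eqxx orbT.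
Qed.

(** C(dim G, k) counts the k-subsets of the free generators of G; after exchanging the sums, all
    C(N,k) subsets contribute equally. *)
Lemma hvec_zonotope k : (k <= d)%N ->
  hvec (fvec V) k = 'C(N, k)%:R * ((-1) ^+ k + (-1) ^+ d).
Proof.
move=> kd; rewrite (hvec_fvec affdim_zonotope).
rewrite (eq_bigr (fun G => \sum_(Z : {set 'I_N} | (#|Z| == k) && (Z \subset free_set G))
    (-1) ^+ affdim V G)); last first.
  move=> G pG; rewrite sumr_const -[RHS]mulr_natr -(affdim_free_set pG) -cards_draws.
  by congr (_ * _%:R); apply: eq_card => Z; rewrite inE unfold_in andbC.
rewrite (exchange_big_dep (fun Z : {set 'I_N} => #|Z| == k)) /=; last by move=> ? ? _ /andP[].
rewrite (eq_bigr (fun=> (-1) ^+ k + (-1) ^+ d)); last first.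
  move=> Z /eqP Zk; rewrite -Zk -sum_faces_containing ?Zk //.
  by apply: eq_bigl => G; rewrite eqxx.
rewrite sumr_const -[LHS]mulr_natl; congr (_%:R * _).
rewrite -[in RHS](card_ord N) -cardsT -cards_draws.
by apply: eq_card => Z; rewrite inE unfold_in subsetT.
Qed.

End Zonotope.

(** * The lattices *)

(** Common form of [zaff_span] (integers, [E] the identity) and [qaff_span] (rationals, [E] the map
    [int2rat]), up to conversion. *)
Definition aff_span (K : nzRingType) n (E : 'rV[int]_n -> 'rV[K]_n)
    (S : 'rV[int]_n -> Prop) (y : 'rV[K]_n) : Prop :=
  exists (k : nat) (c : 'I_k -> K) (v : 'I_k -> 'rV[int]_n),
    (forall i, S (v i)) /\ \sum_(i < k) c i = 1 /\ y = \sum_(i < k) c i *: E (v i).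

Section AffineSpan.
Variables (K : nzRingType) (n : nat) (E : 'rV[int]_n -> 'rV[K]_n).
Variable (S : 'rV[int]_n -> Prop).

Lemma aff_span_mem x : S x -> aff_span E S (E x).
Proof.
move=> Sx; exists 1%N, (fun=> 1), (fun=> x); split=> //.
by rewrite !big_ord1 scale1r.
Qed.

(** The coefficients total 1 + 1 - 1. Closure under this operation makes the translates by F_0
    subgroups. *)
Lemma aff_spanDB x y z :
  aff_span E S x -> aff_span E S y -> aff_span E S z -> aff_span E S (x + (y - z)).
Proof.
move=> [k1 [c1 [v1 [S1 [s1 ->]]]]] [k2 [c2 [v2 [S2 [s2 ->]]]]] [k3 [c3 [v3 [S3 [s3 ->]]]]].
pose glue T (f1 : 'I_k1 -> T) (f2 : 'I_k2 -> T) (f3 : 'I_k3 -> T) (i : 'I_(k1 + (k2 + k3))) :=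
  match split i with
  | inl i1 => f1 i1
  | inr j => match split j with inl i2 => f2 i2 | inr i3 => f3 i3 end
  end.
exists (k1 + (k2 + k3))%N, (glue _ c1 c2 (fun i => - c3 i)), (glue _ v1 v2 v3).
have glue1 T f1 f2 f3 i : @glue T f1 f2 f3 (lshift _ i) = f1 i.
  by rewrite /glue -[lshift _ i]/(unsplit (inl i)) unsplitK.
have glue2 T f1 f2 f3 i : @glue T f1 f2 f3 (rshift _ (lshift _ i)) = f2 i.
  rewrite /glue -[rshift _ _]/(unsplit (inr (lshift _ i))) unsplitK.
  by rewrite -[lshift _ i]/(unsplit (inl i)) unsplitK.
have glue3 T f1 f2 f3 i : @glue T f1 f2 f3 (rshift _ (rshift _ i)) = f3 i.
  rewrite /glue -[rshift _ _]/(unsplit (inr (rshift k2 i))) unsplitK.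
  by rewrite -[rshift _ i]/(unsplit (inr i)) unsplitK.
split; first by move=> i; rewrite /glue; case: split => // j; case: split.
split; rewrite !big_split_ord /=.
  under eq_bigr do rewrite glue1.
  under [X in _ + (X + _)]eq_bigr do rewrite glue2.
  under [X in _ + (_ + X)]eq_bigr do rewrite glue3.
  by rewrite sumrN s1 s2 s3 subrr addr0.
under [X in _ = X + _]eq_bigr do rewrite !glue1.
under [X in _ = _ + (X + _)]eq_bigr do rewrite !glue2.
under [X in _ = _ + (_ + X)]eq_bigr do rewrite !glue3 scaleNr.
by rewrite sumrN.
Qed.

End AffineSpan.

Lemma unit_triangular n (M : 'M[int]_n) : is_trig_mx M -> (forall i, M i i \is a GRing.unit) ->
  M \in unitmx.
Proof.
move=> tM uM; rewrite unitmxE (det_trig tM).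
by apply: (big_ind (fun x => x \is a GRing.unit)) => // x y; rewrite unitrM => -> ->.
Qed.

(** * The transformation from f to h, and the h-numbers of the cube *)

Section FVectorAlgebra.
Variable d : nat.
Implicit Types x y : 'rV[int]_d.+1.

Definition hmx : 'M[int]_d.+1 := \matrix_(j, k) ((-1) ^+ j * 'C(j, k)%:R).

Lemma hvec_mulmx x (k : 'I_d.+1) : hvec x k = (x *m hmx) 0 k.
Proof. by rewrite mxE; apply: eq_bigr => j _; rewrite mxE. Qed.

Lemma hmx_unit : hmx \in unitmx.
Proof.
apply: unit_triangular => [|i].
  by apply/is_trig_mxP => i j ij; rewrite mxE bin_small ?mulr0.
by rewrite mxE binn mulr1 unitrX // unitrN unitr1.
Qed.

Lemma hvec_inj x y : (forall k : 'I_d.+1, hvec x k = hvec y k) -> x = y.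
Proof.
move=> h; rewrite -[x](mulmxK hmx_unit) -[y](mulmxK hmx_unit); congr (_ *m _).
by apply/rowP => k; rewrite -!hvec_mulmx.
Qed.

Definition binmx N : 'M[int]_d.+1 := \matrix_(j, k) 'C(N + j, k)%:R.

(* Vandermonde's convolution factors the matrix into two unitriangular ones. *)
Lemma binmx_unit N : binmx N \in unitmx.
Proof.
pose A : 'M[int]_d.+1 := \matrix_(j, i) 'C(j, i)%:R.
pose B : 'M[int]_d.+1 := \matrix_(i, k) (if (i <= k)%N then 'C(N, k - i)%:R else 0).
have -> : binmx N = A *m B.
  apply/matrixP => j k; rewrite !mxE addnC -binomial.Vandermonde natr_sum.
  rewrite (big_ord_widen_cond d.+1 xpredT (fun i => ('C(j, i) * 'C(N, k - i))%:R)) //.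
  rewrite big_mkcond /=; apply: eq_bigr => i _; rewrite !mxE ltnS.
  by case: leqP => _; rewrite ?mulr0 // natrM.
rewrite unitmx_mul unit_triangular /=; first 1 last.
- by apply/is_trig_mxP => i j ij; rewrite mxE bin_small.
- by move=> i; rewrite mxE binn unitr1.
rewrite -unitmx_tr unit_triangular // => [|i]; last by rewrite !mxE leqnn subnn bin0 unitr1.
by apply/is_trig_mxP => i j ij; rewrite !mxE leqNgt ij.
Qed.

Lemma sum_pow2_bin (A : comNzRingType) (r : A) :
  \sum_(i < d.+1) (2 ^ (d.+1 - i) * 'C(d.+1, i))%:R * r ^+ i = (2 + r) ^+ d.+1 - r ^+ d.+1.
Proof.
rewrite exprDn [in RHS]big_ord_recr /= subnn expr0 mul1r binn mulr1n addrK.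
by apply: eq_bigr => i _; rewrite natrM natrX mulrAC mulr_natr.
Qed.

Lemma F0E (k : 'I_d.+1) : F0 d 0 k = (2 ^ (d.+1 - k) * 'C(d.+1, k))%:R.
Proof.
rewrite mxE (_ : 2%:P = 2) ?rmorph_nat // -sum_pow2_bin coef_sum (bigD1 k) //= big1 ?addr0.
  by rewrite -polyC_natr coefCM coefXn eqxx mulr1.
move=> i ik; rewrite -polyC_natr coefCM coefXn; case: eqP => [e|_]; last by rewrite mulr0.
by rewrite -val_eqE /= e eqxx in ik.
Qed.

Lemma F0_even (j : 'I_d.+1) : (2 %| F0 d ord0 j)%Z.
Proof. by rewrite F0E subSn ?expnS ?natz; [lia|rewrite -ltnS]. Qed.

(** Substituting -(1+X) for t in the cube polynomial gives (1-X)^(d+1) + (-1)^d (1+X)^(d+1). *)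
Lemma hvec_F0 (k : 'I_d.+1) : hvec (F0 d) k = 'C(d.+1, k)%:R * ((-1) ^+ k + (-1) ^+ d).
Proof.
transitivity ((\sum_(i < d.+1)
    (2 ^ (d.+1 - i) * 'C(d.+1, i))%:R * (- (1 + 'X)) ^+ i : {poly int})`_k).
  rewrite coef_sum; apply: eq_bigr => i _; rewrite F0E -polyC_natr coefCM; congr (_ * _).
  rewrite [in RHS]exprNn -[in LHS]signr_odd -[in RHS]signr_odd.
  by case: odd; rewrite ?expr1 ?expr0 ?mulN1r ?mul1r ?coefN coef_oneD_X_exp.
rewrite sum_pow2_bin (_ : 2 + - (1 + 'X) = (1 + 'X) \Po (- 'X)); last first.
  by rewrite rmorphD rmorph1 /= comp_polyX; ring.
rewrite -rmorphXn coefB /= coef_comp_polyN coef_oneD_X_exp.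
rewrite [in X in _ - X]exprNn exprS mulN1r mulNr coefN opprK.
rewrite -[(-1) ^+ d in LHS]signr_odd -[(-1) ^+ d in RHS]signr_odd.
by case: odd; rewrite ?expr1 ?expr0 ?mulN1r ?mul1r ?coefN coef_oneD_X_exp; ring.
Qed.

End FVectorAlgebra.

(** * Comparison of the two lattices *)

Section Lattices.
Variables (R : realType) (d : nat).
Local Notation n := d.+1.
Implicit Types x y : 'rV[int]_n.

Definition zonotope_fvec N : 'rV[int]_n := fvec (zonotope R d N).

Lemma zonotope_fvec_Lset N : (d < N)%N -> Lset R d (zonotope_fvec N).
Proof.
move=> dN; apply: (aff_span_mem id); exists _, (zonotope R d N).
by split; [exact: affdim_zonotope|split=> //; exact: cubical_zonotope].
Qed.

(** Agreement of the h-numbers suffices, so the faces of the cube need not be counted. *)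
Lemma F0_zonotope : F0 d = zonotope_fvec n.
Proof.
by apply: hvec_inj => k; rewrite hvec_F0 hvec_zonotope // -ltnS.
Qed.

Lemma F0_Lset : Lset R d (F0 d).
Proof. by rewrite F0_zonotope; apply: zonotope_fvec_Lset. Qed.

(** Stated over any ring because the equations have to pass through integral and rational affine
    combinations alike. *)
Definition dehn_sommerville_vec (K : nzRingType) (h : 'rV[K]_n) : Prop :=
  h 0 0 = 1 + (-1) ^+ d /\ forall k : 'I_n, odd k != odd d -> h 0 k = 0.

Lemma dehn_sommerville_aff (K : nzRingType) (I : finType) (c : I -> K) (h : I -> 'rV[K]_n) :
  \sum_i c i = 1 -> (forall i, dehn_sommerville_vec (h i)) ->
  dehn_sommerville_vec (\sum_i c i *: h i).
Proof.
move=> c1 hh; split=> [|k kd]; rewrite summxE.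
  under eq_bigr do rewrite mxE (proj1 (hh _)).
  by rewrite -mulr_suml c1 mul1r.
by rewrite big1 // => i _; rewrite mxE (proj2 (hh i)) ?mulr0.
Qed.

Lemma dehn_sommerville_Lset x : Lset R d x -> dehn_sommerville_vec (x *m hmx d).
Proof.
move=> [k [c [v [vP [c1 ->]]]]]; rewrite mulmx_suml.
under eq_bigr do rewrite -scalemxAl.
apply: dehn_sommerville_aff => // i; have [m [V [Vd [Vc ->]]]] := vP i.
split=> [|j jd]; rewrite -hvec_mulmx; first exact: hvec0_fvec.
exact: dehn_sommerville.
Qed.

Lemma dehn_sommerville_Rset x : Rset R d x -> dehn_sommerville_vec (x *m hmx d).
Proof.
move=> [_ [k [c [v [vL [c1 e]]]]]].
have [h0 h1] : dehn_sommerville_vec (int2rat (x *m hmx d)).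
  rewrite /int2rat map_mxM -/(int2rat x) e mulmx_suml; under eq_bigr do rewrite -scalemxAl.
  apply: dehn_sommerville_aff => // i; rewrite -map_mxM.
  have [g0 g1] := dehn_sommerville_Lset (vL i).
  split=> [|j jd]; rewrite mxE; first by rewrite g0 rmorphD rmorph1 rmorph_sign.
  by rewrite g1 // rmorph0.
split=> [|j jd]; apply: (@intr_inj rat).
  by have := h0; rewrite /int2rat [X in X = _ -> _]mxE => ->; rewrite rmorphD rmorph1 rmorph_sign.
by have := h1 j jd; rewrite /int2rat [X in X = _ -> _]mxE => ->; rewrite rmorph0.
Qed.

Lemma Rset_sub_Lset x : Rset R d x -> Lset R d x.
Proof.
move=> Rx; have [h0 h1] := dehn_sommerville_Rset Rx; have [ev _] := Rx.
pose z := map_mx (fun a : int => (a %/ 2)%Z) x.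
have xz : x = 2 *: z by apply/rowP => j; rewrite !mxE mulrC divzK // ev.
(* For k > 0 of the parity of d this is h_k(x) divided by (-1)^k + (-1)^d = 2 (-1)^d, an integer
   since h(x) = 2 h(z). *)
pose e : 'rV[int]_n := \row_k
  if k == 0 then 1 else if odd k == odd d then (-1) ^+ d * (z *m hmx d) 0 k else 0.
pose c := e *m invmx (binmx d n).
have cW : c *m binmx d n = e by rewrite mulmxKV // binmx_unit.
clearbody c.
exists n, (c 0), (fun j => zonotope_fvec (n + j)); split; last split.
- move=> j; exists _, (zonotope R d (n + j)); have dj : (d < n + j)%N by rewrite leq_addr.
  by split; [exact: affdim_zonotope|split=> //; exact: cubical_zonotope].
(* Column 0 of the binomial matrix consists of ones, so the entry 1 of [e] at 0 is the sum of the
   coefficients. *)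
- have := congr1 (fun u : 'rV_n => u 0 0) cW; rewrite [RHS]mxE mxE eqxx => <-.
  by apply: eq_bigr => j _; rewrite mxE bin0 mulr1.
apply: hvec_inj => k; rewrite !hvec_mulmx mulmx_suml summxE.
transitivity (e 0 k * ((-1) ^+ k + (-1) ^+ d)); last first.
  rewrite -cW mxE mulr_suml; apply: eq_bigr => j _.
  rewrite -scalemxAl [RHS]mxE -hvec_mulmx hvec_zonotope ?leq_addr //; last first.
    by rewrite -ltnS.
  by rewrite [binmx _ _ _ _]mxE mulrA.
rewrite [e _ _]mxE; have [->|k0] := eqVneq k 0; first by rewrite h0 mul1r.
case: eqP => [kd|/eqP kd]; last by rewrite h1 // mul0r.
have sgn : (-1) ^+ d * (-1) ^+ d = 1 :> int by rewrite -expr2 sqrr_sign.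
rewrite {1}xz -scalemxAl [LHS]mxE -[(-1) ^+ k]signr_odd kd signr_odd.
by rewrite -[LHS]mulr1 -[X in _ * X = _]sgn; ring.
Qed.

Lemma even_Lset_Rset x : (forall j, (2 %| x ord0 j)%Z) -> Lset R d x -> Rset R d x.
Proof. by move=> ev Lx; split=> //; apply: (aff_span_mem (@int2rat n)). Qed.

Lemma LsetDB x y z : Lset R d x -> Lset R d y -> Lset R d z -> Lset R d (x + (y - z)).
Proof. exact: (@aff_spanDB int n id). Qed.

Lemma RsetDB x y z : Rset R d x -> Rset R d y -> Rset R d z -> Rset R d (x + (y - z)).
Proof.
move=> Rx Ry Rz; apply: even_Lset_Rset.
  move=> j; case: Rx Ry Rz => e1 _ [e2 _] [e3 _]; rewrite !mxE.
  by rewrite rpredD ?rpredB.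
by apply: LsetDB; apply: Rset_sub_Lset.
Qed.

Lemma F0_Rset : Rset R d (F0 d).
Proof. by apply: even_Lset_Rset; [exact: F0_even|exact: F0_Lset]. Qed.

End Lattices.

Theorem theorem3p1 (R : realType) (d : nat) :
  is_subgroup (shift (Lset R d) (F0 d)) /\
  is_subgroup (shift (Rset R d) (F0 d)) /\
  (forall y, shift (Rset R d) (F0 d) y -> shift (Lset R d) (F0 d) y) /\
  same_rank (shift (Rset R d) (F0 d)) (shift (Lset R d) (F0 d)).
Proof.
have diffE (x y : 'rV[int]_d.+1) : x - y + F0 d = F0 d + ((x + F0 d) - (y + F0 d)).
  by apply/rowP => j; rewrite !mxE; ring.
split; first split; rewrite /shift ?add0r; first exact: F0_Lset.
  by move=> x y Lx Ly; rewrite diffE; apply: LsetDB => //; apply: F0_Lset.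
split; first split; rewrite /shift ?add0r; first exact: F0_Rset.
  by move=> x y Lx Ly; rewrite diffE; apply: RsetDB => //; apply: F0_Rset.
split=> [y|k]; first exact: Rset_sub_Lset.
split=> -[v [vS vfree]]; first by exists v; split=> // i; apply: Rset_sub_Lset.
(* Doubling keeps independence, and 2v + F_0 is even and an affine combination of v + F_0 and
   F_0. *)
exists (fun i => 2 *: v i); split=> [i|].
  apply: even_Lset_Rset => [j|].
    by rewrite mxE rpredD ?F0_even // mxE dvdz_mulr.
  rewrite (_ : 2 *: v i + F0 d = (v i + F0 d) + ((v i + F0 d) - F0 d)).
    by apply: LsetDB => //; apply: F0_Lset.
  by apply/rowP => j; rewrite !mxE; ring.
set M := \matrix_(_, _) _ in vfree.
rewrite (_ : \matrix_(_, _) _ = 2 *: M); first by rewrite /row_free mxrank_scale_nz.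
by apply/matrixP => i j; rewrite !mxE rmorphM.
Qed.
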